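(* Let $K$ be a field, $S=K[x_1,\dots,x_n]$, and let $I\subset S$ be a polymatroidal ideal without embedded associated primes. Then $\mathrm{reg}\,I^{(k)}\ge\mathrm{reg}\,I^{k}$ for all $k\ge1$.
   Context: $S$ is standard graded; $\mathrm{reg}$ is Castelnuovo–Mumford regularity. The $k$th symbolic power is $I^{(k)}=\bigcap_{P\in\mathrm{Ass}(I)}(I^kS_P\cap S)$, with $\mathrm{Ass}(I)=\mathrm{Ass}(S/I)$. Let $\mathcal{G}(I)$ be the minimal monomial generating set of a monomial ideal $I$ and $\deg_{x_i}(u)$ the exponent of $x_i$ in a monomial $u$. A nonzero monomial ideal $I$ is *polymatroidal* if it is generated in a single degree and for all $u,v\in\mathcal{G}(I)$ and every $i$ with $\deg_{x_i}(u)>\deg_{x_i}(v)$ there is $j$ with $\deg_{x_j}(u)<\deg_{x_j}(v)$ and $x_j(u/x_i)\in\mathcal{G}(I)$. *)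

(* Defs.v *)
From mathcomp Require Import all_boot all_order all_algebra.
From mathcomp Require Import mpoly.
From mathcomp Require Import boolp classical_sets constructive_ereal.

Set Implicit Arguments.
Unset Strict Implicit.
Unset Printing Implicit Defensive.

Import Order.TTheory GRing.Theory Num.Theory.

Local Open Scope classical_set_scope.
Local Open Scope ring_scope.

Section Ideals.
Variable R : comNzRingType.
Implicit Types I J P Q : set R.

(* Unlike [idealr_closed], this does not exclude the unit ideal. *)
Definition is_ideal I : Prop :=
  [/\ I 0, forall x y, I x -> I y -> I (x + y) & forall a x, I x -> I (a * x)].

Definition ideal_gen (G : set R) : set R := smallest is_ideal G.

Definition ideal_mul I J : set R :=
  ideal_gen [set z | exists x y, [/\ I x, J y & z = x * y]].

Definition ideal_exp I (k : nat) : set R := iter k (ideal_mul I) setT.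

Definition is_prime_ideal P : Prop :=
  [/\ is_ideal P, ~ P 1 & forall x y, P (x * y) -> P x \/ P y].

(* Ass(R/I): the primes that are annihilators of an element f + I of R/I. *)
Definition Ass I : set (set R) :=
  [set P | is_prime_ideal P /\ exists f, P = [set a | I (a * f)]].

Definition no_embedded_primes I : Prop :=
  forall P Q, Ass I P -> Ass I Q -> Q `<=` P -> Q = P.

End Ideals.

Section SymbolicPowers.
Variable R : idomainType.
Implicit Types I J P : set R.

(* The extension J R_P, where R_P is the localization of R at P, viewed inside
   the fraction field of R. *)
Definition loc_ext P J : set {fraction R} :=
  [set x | exists a s, [/\ J a, ~ P s & x = tofrac a / tofrac s]].

Definition symbolic_power I (k : nat) : set R :=
  \bigcap_(P in Ass I) (@tofrac R @^-1` loc_ext P (ideal_exp I k)).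

End SymbolicPowers.

Section Polymatroidal.
Variables (K : fieldType) (n : nat).
Implicit Types (I : set {mpoly K[n]}) (A B : set 'X_{1..n}).

Definition monomial_ideal A : set {mpoly K[n]} :=
  ideal_gen [set 'X_[m] | m in A].

(* Monomials are represented by their exponent vectors. *)
Definition min_monomial_gens I A : Prop :=
  I = monomial_ideal A /\ forall B, B `<=` A -> I = monomial_ideal B -> B = A.

(* A monomial ideal has exactly one minimal monomial generating set, so [A]
   below is G(I). *)
Definition polymatroidal I : Prop :=
  I <> [set 0] /\
  exists A, [/\ min_monomial_gens I A,
    exists d, forall u, A u -> mdeg u = d &
    forall u v, A u -> A v -> forall i : 'I_n, (v i < u i)%N ->
      exists j : 'I_n, (u j < v j)%N /\ A (u - U_(i) + U_(j))%MM].

End Polymatroidal.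

Section Regularity.
Variables (K : fieldType) (n : nat).
Local Notation S := {mpoly K[n]}.

(* Homogeneous of degree d - e, where d - e may be negative. *)
Definition homog_diff (d e : nat) (p : S) : Prop :=
  if (e <= d)%N then (p \is (d - e).-homog : Prop) else p = 0.

(* A minimal graded free resolution ... -> F_1 -> F_0 -> I -> 0 of an ideal I,
   where F_i is the direct sum of the S(- mfr_deg i a), a < mfr_rk i.  Elements
   of F_i are row vectors and the maps act by multiplication on the right.
   Nonnegative twists are enough: a minimal resolution of an ideal has no
   others.  The last field says that F_(i+1) is sent into (x_1,...,x_n) F_i. *)
Record min_free_res (I : set S) := MinFreeRes {
  mfr_rk : nat -> nat;
  mfr_deg : forall i, 'I_(mfr_rk i) -> nat;
  mfr_aug : 'cV[S]_(mfr_rk 0);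
  mfr_d : forall i, 'M[S]_(mfr_rk i.+1, mfr_rk i);
  mfr_aug_homog : forall a, mfr_aug a 0 \is (mfr_deg a).-homog;
  mfr_d_homog : forall i a b,
    homog_diff (mfr_deg a) (mfr_deg b) (mfr_d i a b);
  mfr_aug_im : forall f, I f <-> exists v : 'rV_(mfr_rk 0),
    (v *m mfr_aug) 0 0 = f;
  mfr_exact0 : forall v : 'rV_(mfr_rk 0),
    v *m mfr_aug = 0 <-> exists w : 'rV_(mfr_rk 1), v = w *m mfr_d 0;
  mfr_exactS : forall i (v : 'rV_(mfr_rk i.+1)),
    v *m mfr_d i = 0 <-> exists w : 'rV_(mfr_rk i.+2), v = w *m mfr_d i.+1;
  mfr_minimal : forall i a b, (mfr_d i a b)@_0%MM = 0
}.

(* reg I = sup {j - i | beta_(i,j)(I) != 0}, where beta_(i,j)(I) is the number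
   of generators of degree j of F_i in a minimal graded free resolution of I;
   it does not depend on the resolution.  In particular reg 0 = -oo. *)
Definition reg (I : set S) : \bar int :=
  supremum -oo%E [set e | exists (F : min_free_res I) i (a : 'I_(mfr_rk F i)),
    e = ((mfr_deg a)%:Z - i%:Z)%:E].

End Regularity.

(* Main.v *)
Require Import Defs.
From mathcomp Require Import all_boot all_order all_algebra.
From mathcomp Require Import mpoly.
From mathcomp Require Import boolp classical_sets constructive_ereal.
From mathcomp Require Import zify ring.

Set Implicit Arguments.
Unset Strict Implicit.
Unset Printing Implicit Defensive.

Import Order.TTheory GRing.Theory Num.Theory.

Local Open Scope classical_set_scope.
Local Open Scope ring_scope.

(** Let [A] be the set of minimal generators of [I], all of degree [d].  Both
    regularities are compared with [k d]: the regularity of [I^k] is at most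
    [k d], and the symbolic power has a minimal generator of degree [k d].

    The symbolic power.  Fix [u] in [A].  If [x_i] divides [x^u], then
    [x^(u - e_i)] is not in [I], so some associated prime [P_T], generated by
    the variables in [T], has [x^(u - e_i)] outside the localization of [I] at
    [P_T] (lemma [ass_exists]).  As [P_T] is a minimal prime, the localization
    contains a power of each variable of [T].  Exchanging towards such pure
    powers turns an element of [A] of least degree on [T] into any monomial of
    that degree on [T]; hence the localization is a power of [P_T], and [u]
    itself has the least degree on [T] (lemma [minimal_on_ass]).  Every sum of
    [k] elements of [A] then has degree at least [k deg_T u] on [T], which
    [x^(k u - e_i)] does not reach.  So [x^(k u)] is a minimal generator of the
    symbolic power (lemma [power_not_divisible]).

    The ordinary power.  Sums of [k] elements of [A] satisfy the exchange
    property again (lemma [sumset_exchange]), so they have linear quotients in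
    the lexicographic order.  This is turned into a bound on an arbitrary
    minimal free resolution through Koszul homology: a Koszul cycle with
    coefficients in the ideal, all of degree greater than [k d], is a boundary
    (lemma [exchange_vanishing]).  For a submodule covered by a free module
    with kernel inside the maximal ideal, the same property passes to the
    kernel with the bound raised by one (lemma [vanishing_shift]), so that the
    generators of the i-th free module have degree at most [k d + i] (lemma
    [resolution_degree_bound]).

    Since the regularity is a supremum over existing minimal resolutions, the
    lower bound also requires a minimal resolution of the symbolic power.  The
    same vanishing property, with a coarser bound that holds for every monomial
    ideal with bounded exponents (lemma [capped_vanishing]), replaces the
    Hilbert basis theorem: by the degree zero part of the Koszul complex, each
    syzygy module is generated in bounded degrees, hence by finitely many
    elements (lemmas [minimal_generators] and [resolution_exists]). *)

(** * Sums of sets with the exchange property *)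

Section Exchange.
Variable n : nat.
Implicit Types (A B : set 'X_{1..n}) (u v w x y z m : 'X_{1..n}).

Definition exchange A := forall u v, A u -> A v ->
  forall i : 'I_n, (v i < u i)%N ->
  exists j : 'I_n, (u j < v j)%N /\ A (u - U_(i) + U_(j))%MM.

Definition sumset A B : set 'X_{1..n} :=
  [set m | exists u v, [/\ A u, B v & m = (u + v)%MM]].

Definition ksum A k := iter k (sumset A) [set 0%MM].

Definition mdist x y := (\sum_i ((x i - y i) + (y i - x i)))%N.

Lemma mdist_move x y i j : (y i < x i)%N -> (x j < y j)%N ->
  (mdist (x - U_(i) + U_(j))%MM y < mdist x y)%N.
Proof.
move=> hi hj.
have ij : i != j by apply/eqP=> ij; rewrite ij in hi; lia.
rewrite /mdist (bigD1 i) //= [X in (_ < X)%N](bigD1 i) //=.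
rewrite mnmDE mnmBE !mnm1E eqxx (eq_sym j) (negbTE ij).
have : (\sum_(k | k != i) (((x - U_(i) + U_(j))%MM k - y k) +
   (y k - (x - U_(i) + U_(j))%MM k)) <= \sum_(k | k != i) ((x k - y k) + (y k - x k)))%N.
  apply: leq_sum => k hk; rewrite mnmDE mnmBE !mnm1E.
  by rewrite (eq_sym i) (negbTE hk); case: eqP => [<-|_]; lia.
by rewrite /=; move: (bigop _ _ _) (bigop _ _ _) => a b; lia.
Qed.

(** Follow a unit that leaves coordinate [i] of [x = x1 + x2]: an exchange in
    one summand moves it from [i] to some [l].  If [x l < y l] this is the
    wanted exchange; otherwise the sum now exceeds [y] at [l], and a further
    exchange at [l], in whichever summand exceeds its target there, moves the
    unit on.  Each step brings the pair of summands closer to [(y1, y2)], so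
    the process stops. *)
Lemma sumset_exchange A B : exchange A -> exchange B -> exchange (sumset A B).
Proof.
move=> eA eB _ _ [x1 [x2 [A1 B2 ->]]] [y1 [y2 [Ay By ->]]] i hi.
set x := (x1 + x2)%MM; set y := (y1 + y2)%MM; rewrite -/x -/y in hi.
suff: forall d z1 z2 c, (mdist z1 y1 + mdist z2 y2 < d)%N -> A z1 -> B z2 ->
   (z1 + z2 = x - U_(i) + U_(c))%MM -> (y c < (z1 + z2)%MM c)%N ->
   exists j : 'I_n, (x j < y j)%N /\ sumset A B (x - U_(i) + U_(j))%MM.
  apply; [exact: ltnSn|exact: A1|exact: B2| |exact: hi].
  by rewrite submK // lep1mP; lia.
elim=> [|d IH] z1 z2 c hd Az Bz Ez hc; first by [].
(* one exchange in either summand moves the surplus from c to some l *)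
have step l z1' z2' : A z1' -> B z2' ->
    (mdist z1' y1 + mdist z2' y2 < mdist z1 y1 + mdist z2 y2)%N ->
    (z1' + z2' = (z1 + z2) - U_(c) + U_(l))%MM ->
    exists j : 'I_n, (x j < y j)%N /\ sumset A B (x - U_(i) + U_(j))%MM.
  move=> Az' Bz' hd' Ez'.
  have Ez'' : (z1' + z2' = x - U_(i) + U_(l))%MM.
    by rewrite Ez' Ez addmK.
  have [xl|xl] := ltnP (x l) (y l).
    by exists l; split=> //; exists z1', z2'; split.
  apply: (IH z1' z2' l) => //; first lia.
  rewrite Ez'' mnmDE mnmBE !mnm1E eqxx.
  by case: eqP => [il|_]; [subst l|]; lia.
have [h1|h1] := ltnP (y1 c) (z1 c).
  have [l [hl Al]] := eA _ _ Az Ay _ h1.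
  apply: (step l _ z2 Al Bz); first by have := mdist_move h1 hl; lia.
  apply/mnmP=> k; rewrite !(mnmDE, mnmBE, mnm1E).
  by case: eqP => [<-|_]; lia.
have h2 : (y2 c < z2 c)%N by move: hc; rewrite /y !mnmDE; lia.
have [l [hl Bl]] := eB _ _ Bz By _ h2.
apply: (step l z1 _ Az Bl); first by have := mdist_move h2 hl; lia.
apply/mnmP=> k; rewrite !(mnmDE, mnmBE, mnm1E).
by case: eqP => [<-|_]; lia.
Qed.

Lemma ksum_exchange A k : exchange A -> exchange (ksum A k).
Proof.
move=> eA; elim: k => [|k IH] /=; last exact: sumset_exchange.
by move=> u v -> -> i; rewrite mnm0E.
Qed.

Lemma ksum_mdeg A d k : (forall u, A u -> mdeg u = d) ->
  forall u, ksum A k u -> mdeg u = (k * d)%N.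
Proof.
move=> hA; elim: k => [|k IH] u /=; first by move->; rewrite mdeg0.
by case=> v [w [Av kw ->]]; rewrite mdegD (hA _ Av) (IH _ kw) mulSn.
Qed.

Lemma ksum_muln A k u : A u -> ksum A k (u *+ k)%MM.
Proof.
move=> Au; elim: k => [|k IH] /=; first by rewrite mulm0n.
by exists u, (u *+ k)%MM; rewrite mulmS.
Qed.

End Exchange.

(** * Monomial ideals *)

Section MonomialIdeals.
Variables (K : fieldType) (n : nat).
Local Notation S := {mpoly K[n]}.
Implicit Types (A B M : set 'X_{1..n}) (u v w m : 'X_{1..n}) (f g p q : S).

Definition upset M := forall m m', M m -> (m <= m')%MM -> M m'.

Definition up A : set 'X_{1..n} := [set m | exists2 u, A u & (u <= m)%MM].

(** For an up-closed [M], the monomial ideal whose monomials are [M]; all ideals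
    below are handled in this form, where membership is read off supports. *)
Definition monid M : set S := [set f | forall m, m \in msupp f -> M m].

Lemma upset_up A : upset (up A).
Proof. by move=> m m' [u Au um] mm'; exists u => //; apply: lepm_trans mm'. Qed.

Lemma monidX M m : monid M 'X_[m] <-> M m.
Proof. by split=> [h|h m' /mem_msuppXP <-//]; apply: h; rewrite msuppX inE. Qed.

Lemma monid0 M : monid M 0.
Proof. by move=> m; rewrite -[0]/(0%:MP) msupp0. Qed.

Lemma monidD M f g : monid M f -> monid M g -> monid M (f + g).
Proof. by move=> hf hg m /msuppD_le; rewrite mem_cat => /orP[/hf|/hg]. Qed.

Lemma monidN M f : monid M f -> monid M (- f).
Proof. by move=> hf m; rewrite (perm_mem (msuppN _)); exact: hf. Qed.

Lemma monidB M f g : monid M f -> monid M g -> monid M (f - g).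
Proof. by move=> hf hg; apply: monidD => //; apply: monidN. Qed.

Lemma monid_sum M (I : Type) (r : seq I) (P : pred I) (F : I -> S) :
  (forall i, P i -> monid M (F i)) -> monid M (\sum_(i <- r | P i) F i).
Proof.
by move=> h; elim/big_rec: _ => [|i x Pi]; [exact: monid0|apply: monidD; exact: h].
Qed.

Lemma monidM M f g : upset M -> monid M g -> monid M (f * g).
Proof.
move=> uM hg m /msuppM_le /allpairsP[[m1 m2] /= [h1 h2 ->]].
by apply: uM (hg _ h2) _; exact: lem_addl.
Qed.

Lemma monid_is_ideal M : upset M -> is_ideal (monid M).
Proof.
by move=> uM; split; [exact: monid0|exact: monidD|move=> a x; exact: monidM].
Qed.

Lemma ideal_sum (I : set S) (T : Type) (r : seq T) (F : T -> S) :
  is_ideal I -> (forall i, I (F i)) -> I (\sum_(i <- r) F i).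
Proof.
by move=> [I0 ID IM] h; elim/big_rec: _ => [//|i x _]; apply: ID.
Qed.

Lemma ideal_genP (G I : set S) :
  is_ideal I -> G `<=` I -> ideal_gen G `<=` I.
Proof. by move=> hI GI f; apply. Qed.

Lemma ideal_gen_ideal (G : set S) : is_ideal (ideal_gen G).
Proof.
split=> [I [[]]//|x y hx hy I hI|a x hx I hI].
  by have [[_ D _] _] := hI; apply: D; [exact: hx|exact: hy].
by have [[_ _ D] _] := hI; apply: D; exact: hx.
Qed.

Lemma sub_ideal_gen (G : set S) : G `<=` ideal_gen G.
Proof. by move=> f Gf I [_]; apply. Qed.

Lemma monid_sub (I : set S) M :
  is_ideal I -> (forall m, M m -> I 'X_[m]) -> monid M `<=` I.
Proof.
move=> hI h f hf; rewrite (mpolyE f) big_seq_cond big_mkcond /=.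
apply: ideal_sum => // m; case: ifP => [/andP[mf _]|_]; last by case: hI.
by rewrite -mul_mpolyC; case: hI => _ _; apply; apply/h/hf.
Qed.

Lemma monomial_idealE A : monomial_ideal A = monid (up A) :> set S.
Proof.
apply/seteqP; split.
  apply: ideal_genP; first exact/monid_is_ideal/upset_up.
  by move=> _ [m Am <-]; apply/monidX; exists m => //; exact: lepm_refl.
apply: monid_sub; first exact: ideal_gen_ideal.
move=> m [u Au um]; rewrite -(submK um) mpolyXD.
have [_ _] := ideal_gen_ideal [set ('X_[m] : S) | m in A]; apply.
by apply: sub_ideal_gen; exists u.
Qed.

Lemma ideal_mulE A B :
  ideal_mul (monid (up A)) (monid (up B)) = monid (up (sumset A B)) :> set S.
Proof.
apply/seteqP; split.
  apply: ideal_genP; first exact/monid_is_ideal/upset_up.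
  move=> _ [f [g [hf hg ->]]] m /msuppM_le /allpairsP[[m1 m2] /= [h1 h2 ->]].
  have [u Au um] := hf _ h1; have [v Bv vm] := hg _ h2.
  exists (u + v)%MM; first by exists u, v.
  apply/mnm_lepP=> i; rewrite !mnmDE.
  by move/mnm_lepP: um => /(_ i); move/mnm_lepP: vm => /(_ i); lia.
apply: monid_sub; first exact: ideal_gen_ideal.
move=> m [_ [u [v [Au Bv ->]]] um]; rewrite -(submK um) mpolyXD.
have [_ _] := ideal_gen_ideal [set z | exists x y : S,
  [/\ monid (up A) x, monid (up B) y & z = x * y]]; apply.
apply: sub_ideal_gen; exists 'X_[u], 'X_[v]; rewrite mpolyXD; split=> //.
  by apply/monidX; exists u => //; exact: lepm_refl.
by apply/monidX; exists v => //; exact: lepm_refl.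
Qed.

Lemma ideal_expE A k : ideal_exp (monid (up A)) k = monid (up (ksum A k)) :> set S.
Proof.
rewrite /ideal_exp /ksum; elim: k => [|k IH] /=; last by rewrite IH ideal_mulE.
apply/seteqP; split=> // f _ m _; exists 0%MM => //.
by apply/mnm_lepP => i; rewrite mnm0E.
Qed.

Lemma mcoeffMXi p i m :
  (p * 'X_i)@_m = if (0 < m i)%N then p@_(m - U_(i)) else 0.
Proof.
case: ifP => hi.
  have h : (U_(i) <= m)%MM by rewrite lep1mP -lt0n.
  by rewrite -(mcoeffMX p U_(i)) addmC submK.
apply: memN_msupp_eq0; rewrite (perm_mem (msuppMX _ _)).
by apply/mapP=> -[m' _ E]; move: hi; rewrite E mnmDE mnm1E eqxx.
Qed.

Lemma mdegBU m i : (0 < m i)%N -> (mdeg (m - U_(i))%MM).+1 = mdeg m.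
Proof.
move=> mi; have h : (U_(i) <= m)%MM by rewrite lep1mP -lt0n.
by rewrite -[in RHS](submK h) mdegD mdeg1 addn1.
Qed.

End MonomialIdeals.

(** * Extremal natural numbers *)

Section Extrema.

Lemma ex_max_nat (P : nat -> Prop) b :
  (exists k, P k) -> (forall k, P k -> (k <= b)%N) ->
  exists k, P k /\ forall j, P j -> (j <= k)%N.
Proof.
move=> [k0 Pk0] hb.
have ex : exists k, `[< P k >] by exists k0; apply/asboolP.
have ub k : `[< P k >] -> (k <= b)%N by move/asboolP/hb.
by case: (ex_maxnP ex ub) => k /asboolP Pk km; exists k; split=> // j /asboolP/km.
Qed.

Lemma ex_min_nat (P : nat -> Prop) :
  (exists k, P k) -> exists k, P k /\ forall j, P j -> (k <= j)%N.
Proof.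
move=> [k0 Pk0].
have ex : exists k, `[< P k >] by exists k0; apply/asboolP.
by case: (ex_minnP ex) => k /asboolP Pk km; exists k; split=> // j /asboolP/km.
Qed.

End Extrema.

(** * Associated primes of monomial ideals *)

Section MonomialPrimes.
Variables (K : fieldType) (n : nat).
Local Notation S := {mpoly K[n]}.
Implicit Types (A B M : set 'X_{1..n}) (u v w m : 'X_{1..n}) (f g p q s a : S).
Implicit Types (T : {set 'I_n}) (P : set S).

(** Up-closedness that only looks at the coordinates in [T]: the monomial ideals
    of this kind are those modulo which the variables off [T] are
    nonzerodivisors, that is, contractions from the localization at the prime
    generated by [T]. *)
Definition cylinder T M :=
  forall m m', M m -> (forall l, l \in T -> (m l <= m' l)%N) -> M m'.

Definition up_on T B : set 'X_{1..n} :=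
  [set m | exists2 v, B v & forall l, l \in T -> (v l <= m l)%N].

Definition hits T : set 'X_{1..n} := [set m | exists2 l, l \in T & (0 < m l)%N].

Definition var_prime T : set S := monid (hits T).

Definition deg_on T m := (\sum_(l in T) m l)%N.

Lemma cylinder_upset T M : cylinder T M -> upset M.
Proof. by move=> cM m m' Mm /mnm_lepP le; apply: cM Mm _ => l _. Qed.

Lemma cylinder_up_on T B : cylinder T (up_on T B).
Proof.
move=> m m' [v Bv vm] mm'; exists v => // l lT.
exact: leq_trans (vm _ lT) (mm' _ lT).
Qed.

Lemma cylinder_hits T : cylinder T (hits T).
Proof. by move=> m m' [l lT ml] mm'; exists l => //; have := mm' _ lT; lia. Qed.

Lemma deg_onD T m m' : deg_on T (m + m')%MM = (deg_on T m + deg_on T m')%N.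
Proof. by rewrite /deg_on -big_split; apply: eq_bigr => l _; rewrite mnmDE. Qed.

Lemma deg_on_eq0 T m l : deg_on T m = 0%N -> l \in T -> m l = 0%N.
Proof.
by move=> /eqP; rewrite sum_nat_eq0 => /forallP/(_ l)/implyP h /h /eqP.
Qed.

Definition mfilter (P : pred 'X_{1..n}) f : S :=
  \sum_(m <- msupp f | P m) f@_m *: 'X_[m].

Lemma mcoeff_mfilter (P : pred 'X_{1..n}) f m :
  (mfilter P f)@_m = if P m then f@_m else 0.
Proof.
rewrite /mfilter raddf_sum /=.
have E m' : (f@_m' *: 'X_[m'])@_m = if m' == m then f@_m else 0.
  by rewrite mcoeffZ mcoeffX; case: eqP => [->|_]; rewrite ?mulr1 ?mulr0.
rewrite (eq_bigr _ (fun m' _ => E m')) -big_mkcondr /=.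
have [mf|mf] := boolP (m \in msupp f); last first.
  by rewrite (memN_msupp_eq0 mf) big1_eq if_same.
rewrite -big_filter.
rewrite (eq_filter (a2 := fun m' => (m' == m) && P m)); last first.
  by move=> m' /=; case: (m' =P m) => [->|_]; rewrite ?andbT ?andbF.
case: (P m).
  rewrite (eq_filter (a2 := pred1 m)) => [|m']; last by rewrite andbT.
  by rewrite filter_pred1_uniq ?msupp_uniq // big_seq1.
by rewrite (eq_filter (a2 := pred0)) ?filter_pred0 ?big_nil // => m'; rewrite andbF.
Qed.

(** Look at the monomials of [f] outside [M], and among them at the part [g] of
    least degree on [T].  Let [s0] be the part of [s] free of the variables of
    [T], which is nonzero.  The product [s0 * g] is nonzero, its monomials are
    outside [M], and it is exactly the part of [s * f] in those monomials. *)
Lemma cylinder_primary T M s f :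
  cylinder T M -> ~ var_prime T s -> monid M (s * f) -> monid M f.
Proof.
move=> cM Ps Msf; have uM := cylinder_upset cM.
apply: contrapT => nMf.
have [e [[m0 [m0f nM0 E0]] emin]] :
    exists e, (exists m, [/\ m \in msupp f, ~ M m & deg_on T m = e]) /\
      forall j, (exists m, [/\ m \in msupp f, ~ M m & deg_on T m = j]) -> (e <= j)%N.
  apply: ex_min_nat; apply: contrapT => h; apply: nMf => m mf.
  by apply: contrapT => nM; apply: h; exists (deg_on T m), m.
pose s0 := mfilter (fun m => deg_on T m == 0%N) s.
pose g := mfilter (fun m => `[< ~ M m >] && (deg_on T m == e)) f.
have s0_neq0 : s0 != 0.
  apply/negP=> /eqP s00; apply: Ps => m ms; apply: contrapT => hm.
  have : s0@_m = 0 by rewrite s00 mcoeff0.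
  rewrite mcoeff_mfilter; case: (deg_on T m =P 0%N) => [_ E|ne _].
    by move: ms; rewrite mcoeff_msupp E eqxx.
  apply: ne; apply/eqP; rewrite sum_nat_eq0; apply/forallP=> l; apply/implyP=> lT.
  by rewrite -leqn0 leqNgt; apply/negP=> ml; apply: hm; exists l.
have g_neq0 : g != 0.
  apply/negP=> /eqP g0; have : g@_m0 = 0 by rewrite g0 mcoeff0.
  rewrite mcoeff_mfilter E0 eqxx (asboolT nM0) /= => E.
  by move: m0f; rewrite mcoeff_msupp E eqxx.
have [m mP] : exists m, m \in msupp (s0 * g).
  exists (mlead (s0 * g)); apply: mlead_supp; by rewrite mulf_neq0.
have [nMm dm] : ~ M m /\ deg_on T m = e.
  move/msuppM_le: (mP) => /allpairsP[[m1 m2] /= [h1 h2 E]].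
  move: h1 h2; rewrite !mcoeff_msupp !mcoeff_mfilter.
  case: (deg_on T m1 =P 0%N) => [d1 _|_]; last by rewrite eqxx.
  case: ifP => [/andP[/asboolP nM /eqP d2] _|_]; last by rewrite eqxx.
  rewrite E deg_onD d1 d2; split=> // Mm; apply: nM; apply: cM Mm _ => l lT.
  by rewrite mnmDE (deg_on_eq0 d1 lT).
have key k1 k2 : m = (k1 + k2)%MM -> s0@_k1 * g@_k2 = s@_k1 * f@_k2.
  move=> Em; rewrite !mcoeff_mfilter.
  have nMk : ~ M k2.
    by move=> Mk; apply: nMm; apply: uM Mk _; rewrite Em; exact: lem_addl.
  rewrite (asboolT nMk) /=.
  have [k2f|k2f] := boolP (k2 \in msupp f); last first.
    by rewrite (memN_msupp_eq0 k2f) if_same !mulr0.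
  have := emin _ (ex_intro _ k2 (And3 k2f nMk (erefl _))).
  have := dm; rewrite Em deg_onD.
  case: (deg_on T k1 =P 0%N) => [->|d1] E le; first by rewrite -E eqxx.
  by lia.
apply: (nMm); apply: Msf; move: mP; rewrite !mcoeff_msupp; congr (_ != 0).
by rewrite !mcoeffM; apply: eq_bigr => -[k1 k2] /= /eqP /key.
Qed.

Lemma var_prime_prime T : is_prime_ideal (var_prime T).
Proof.
split.
- exact/monid_is_ideal/(cylinder_upset (@cylinder_hits T)).
- move=> h1; have [|l _] := h1 0%MM; first by rewrite -[1]/(1%:MP) msupp1 inE.
  by rewrite mnm0E.
move=> x y xy; have [|nx] := EM (var_prime T x); first by left.
by right; apply: cylinder_primary nx xy; exact: cylinder_hits.
Qed.

(** The leading monomial of [a * f] lies in [M], so multiplying [f] by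
    the leading monomial of [a] puts its leading term into the ideal.  What is
    left has fewer terms and is again multiplied into the ideal by [a]. *)
Lemma lead_annihilates M a f : upset M -> a != 0 -> monid M (a * f) ->
  exists N, monid M ('X_[mlead a] ^+ N * f).
Proof.
move=> uM a0; move: {2}(size _) (leqnn (size (msupp f))) => r.
elim: r f => [|r IH] f hr hf.
  have -> : f = 0 by apply: msuppnil0; apply/nilP; rewrite /nilp -leqn0.
  by exists 0%N; rewrite mulr0; exact: monid0.
have [->|f0] := eqVneq f 0; first by exists 0%N; rewrite mulr0; exact: monid0.
pose c := f@_(mlead f); pose f' := f - c *: 'X_[mlead f].
have Mlead : M (mlead a + mlead f)%MM.
  by apply: hf; rewrite mcoeff_msupp mleadcM mulf_neq0 // mleadc_eq0.
have MX : monid M ('X_[mlead a] * (c *: 'X_[mlead f])).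
  rewrite -scalerAr -mpolyXD -mul_mpolyC; apply: monidM => //; exact/monidX.
have [N hN] : exists N, monid M ('X_[mlead a] ^+ N * (f' * 'X_[mlead a])).
  apply: IH.
    rewrite (perm_size (msuppMX _ _)) size_map (perm_size (msupp_rem _ _)).
    by rewrite size_rem ?mlead_supp // -subn1 leq_subLR.
  rewrite mulrA mulrBr mulrBl; apply: monidB; first by rewrite mulrC; apply: monidM.
  by rewrite -mulrA (mulrC (c *: _)); apply: monidM.
exists N.+1; rewrite -[f](subrK (c *: 'X_[mlead f])) -/f' mulrDr.
apply: monidD; first by rewrite exprSr -mulrA (mulrC _ f').
by rewrite exprSr -mulrA; apply: monidM.
Qed.

Lemma prime_expX P (x : S) N : is_prime_ideal P -> P (x ^+ N) -> P x.
Proof.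
move=> [[_ _ _] P1 PM]; elim: N => [|N IH]; first by rewrite expr0.
by rewrite exprS => /PM[|/IH].
Qed.

Lemma colon_prime_monomial M P f : upset M -> is_prime_ideal P ->
  P = [set a | monid M (a * f)] ->
  forall a, P a -> forall m, m \in msupp a -> P 'X_[m].
Proof.
move=> uM pP EP a; move: {2}(size _) (leqnn (size (msupp a))) => r.
elim: r a => [|r IH] a hr Pa m ma.
  by move: hr ma; rewrite leqn0 size_eq0 => /eqP ->.
have a0 : a != 0 by apply: contraTneq ma => ->; rewrite -[0]/(0%:MP) msupp0.
have PX : P 'X_[mlead a].
  have [N hN] : exists N, monid M ('X_[mlead a] ^+ N * f).
    by apply: lead_annihilates => //; move: Pa; rewrite EP.
  by apply: (@prime_expX _ _ N) => //; rewrite EP.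
have [->//|mne] := eqVneq m (mlead a).
apply: (IH (a - a@_(mlead a) *: 'X_[mlead a])).
- by rewrite (perm_size (msupp_rem _ _)) size_rem ?mlead_supp // -subn1 leq_subLR.
- have [[_ PD PM] _ _] := pP; apply: PD => //.
  by rewrite -scaleNr -mul_mpolyC; apply: PM.
by rewrite (perm_mem (msupp_rem _ _)) mem_rem_uniq ?msupp_uniq // inE mne.
Qed.

Lemma colon_prime_var M P f : upset M -> is_prime_ideal P ->
  P = [set a | monid M (a * f)] -> exists T, P = var_prime T.
Proof.
move=> uM pP EP; exists [set l | `[< P 'X_l >]]%SET; apply/seteqP; split.
  move=> a Pa m ma; have := colon_prime_monomial uM pP EP Pa ma.
  move: {2}(mdeg m) (leqnn (mdeg m)) => r; elim: r m {ma} => [|r IH] m hr PX.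
    case: pP => _ P1 _; case: P1; move: hr; rewrite leqn0 mdeg_eq0 => /eqP m0.
    by rewrite m0 mpolyX0 in PX.
  have [/forallP m0|] := boolP [forall l, m l == 0%N].
    apply: IH => //; rewrite mdegE big1 // => l _; exact/eqP.
  rewrite negb_forall => /existsP[l ml].
  have h : (U_(l) <= m)%MM by rewrite lep1mP.
  have : P ('X_[m - U_(l)] * 'X_l) by rewrite -mpolyXD submK.
  case: pP => _ _ PM /PM[|Pl].
    move=> Pm; have [|i iT] := IH _ _ Pm; first by rewrite -ltnS mdegBU // lt0n.
    by rewrite mnmBE => mi; exists i => //; lia.
  by exists l; rewrite ?inE ?lt0n //; exact/asboolP.
apply: monid_sub; first by case: pP.
move=> m [l]; rewrite inE => /asboolP Pl ml.
have h : (U_(l) <= m)%MM by rewrite lep1mP -lt0n.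
by rewrite -(submK h) mpolyXD; case: pP => -[_ _ PM] _ _; apply: PM.
Qed.

End MonomialPrimes.

(** * Localization and symbolic powers *)

Section Localization.
Variables (K : fieldType) (n : nat).
Local Notation S := {mpoly K[n]}.
Implicit Types (A B M : set 'X_{1..n}) (u v w m : 'X_{1..n}) (f g p q s a : S).
Implicit Types (T : {set 'I_n}) (P : set S).

(** The nontrivial implication is [cylinder_primary]; conversely a large power
    of the product of the variables off [T] is a denominator for every element
    of the right-hand side. *)
Lemma loc_ext_var_prime T B D f : (forall v, B v -> forall l, (v l <= D)%N) ->
  loc_ext (var_prime T) (monid (up B)) (tofrac f) <-> monid (up_on T B) f.
Proof.
move=> hB; split.
  move=> [a [s [Ia Ps E]]].
  have s0 : s != 0.
    by apply/negP=> /eqP s0; apply: Ps; rewrite s0; exact: monid0.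
  have Ea : s * f = a.
    apply/eqP; rewrite -(tofrac_eq (s * f)) tofracM E mulrC divfK //.
    by rewrite tofrac_eq0.
  apply: (@cylinder_primary _ _ T _ s) => //; first exact: cylinder_up_on.
  rewrite Ea => m /Ia[v Bv /mnm_lepP vm]; exists v => // l _; exact: vm.
move=> hf; pose w := [multinom (if l \in T then 0 else D)%N | l < n].
have s0 : ('X_[w] : S) != 0.
  by rewrite -msize_poly_eq0 msizeX.
exists ('X_[w] * f), 'X_[w]; split.
- move=> m; rewrite mulrC (perm_mem (msuppMX _ _)) => /mapP[m' /hf[v Bv vm] ->].
  exists v => //; apply/mnm_lepP=> l; rewrite mnmDE mnmE.
  by case: ifP => [/vm|_] //; have := hB _ Bv l; lia.
- by move/(_ w); rewrite msuppX inE eqxx => /(_ isT)[l lT]; rewrite mnmE lT.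
by rewrite tofracM mulrAC divff ?mul1r // tofrac_eq0.
Qed.

Variables (A : set 'X_{1..n}) (d : nat).
Hypothesis A_deg : forall u, A u -> mdeg u = d.
Local Notation I := (monid (up A) : set S).

Lemma le_mdeg m l : (m l <= mdeg m)%N.
Proof. by rewrite mdegE (bigD1 l) //= leq_addr. Qed.

(** Among the monomials outside [I], with exponents at most [d], divisible by
    [x^f] (capped at [d]) and with exponent [d] off [T], take one, [x^m], of
    largest degree.  A variable of exponent less than [d] in [x^m] multiplies it
    into [I] by maximality, while one of exponent [d] can be raised at will
    without entering [I].  So [I : x^m] is the prime of the former variables. *)
Lemma ass_exists T (f : 'X_{1..n}) : ~ up_on T A f ->
  exists T', [/\ T' \subset T, Ass I (var_prime T') & ~ up_on T' A f].
Proof.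
move=> hf.
pose box m := [/\ forall l, (m l <= d)%N, forall l, (minn (f l) d <= m l)%N,
  forall l, l \notin T -> m l = d & ~ up A m].
have [e [[m [[mle mge mT nm] Em]] emax]] :
    exists e, (exists m, box m /\ mdeg m = e) /\
      forall j, (exists m, box m /\ mdeg m = j) -> (j <= e)%N.
  apply: (@ex_max_nat _ (n * d)%N); last first.
    move=> _ [m [[hm _ _ _] <-]]; rewrite mdegE.
    by rewrite -[X in (_ <= X * _)%N]card_ord -sum_nat_const; apply: leq_sum.
  pose m0 := [multinom (if l \in T then minn (f l) d else d) | l < n].
  exists (mdeg m0), m0; split=> //; split.
  - by move=> l; rewrite mnmE; case: ifP => _ //; exact: geq_minr.
  - by move=> l; rewrite mnmE; case: ifP => _ //; exact: geq_minr.
  - by move=> l lT; rewrite mnmE (negbTE lT).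
  move=> [v Av /mnm_lepP vm]; apply: hf; exists v => // l lT.
  by have := vm l; rewrite mnmE lT; lia.
pose T' := [set l | (m l < d)%N]%SET.
have up1 l : l \in T' -> up A (m + U_(l))%MM.
  rewrite inE => ml; apply: contrapT => nup.
  suff /emax : exists m', box m' /\ mdeg m' = e.+1 by rewrite ltnn.
  exists (m + U_(l))%MM; split; last by rewrite mdegD mdeg1 Em addn1.
  split=> // [i|i|i iT]; rewrite mnmDE mnm1E.
  - by case: eqP => [<-|_]; rewrite ?addn1 ?addn0.
  - exact: leq_trans (mge i) (leq_addr _ _).
  case: eqP => [li|_]; last by rewrite addn0; exact: mT.
  by move: ml; rewrite li (mT _ iT) ltnn.
exists T'; split.
- apply/fintype.subsetP=> l; rewrite inE => ml; apply: contraLR ml => lT.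
  by rewrite (mT _ lT) ltnn.
- split; first exact: var_prime_prime.
  exists 'X_[m]; apply/seteqP; split=> a ha.
    move=> m2; rewrite (perm_mem (msuppMX _ _)) => /mapP[m' /ha[l lT ml] ->].
    apply: upset_up (up1 _ lT) _; apply/mnm_lepP=> i; rewrite !mnmDE mnm1E.
    by case: eqP => [<-|_]; lia.
  move=> m' ma; apply: contrapT => nh.
  have /ha[v Av /mnm_lepP vm] : (m + m')%MM \in msupp (a * 'X_[m]).
    by rewrite (perm_mem (msuppMX _ _)) map_f.
  apply: nm; exists v => //; apply/mnm_lepP=> l.
  have [lT|] := boolP (l \in T'); last first.
    by rewrite inE -leqNgt; have := le_mdeg v l; rewrite (A_deg Av); lia.
  have := vm l; rewrite mnmDE; suff -> : m' l = 0%N by rewrite addn0.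
  by apply/eqP; rewrite -leqn0 leqNgt; apply/negP=> ml; apply: nh; exists l.
move=> [v Av vf]; apply: nm; exists v => //; apply/mnm_lepP=> l.
have vd : (v l <= d)%N by rewrite -(A_deg Av) le_mdeg.
have [lT|] := boolP (l \in T'); last by rewrite inE -leqNgt; lia.
by have := vf _ lT; have := mge l; lia.
Qed.

(** The monomials of the k-th symbolic power; quantifying over sets of variables
    is enough because associated primes of monomial ideals are generated by
    variables. *)
Definition symbolic_monomials k : set 'X_{1..n} :=
  [set m | forall T, Ass I (var_prime T) -> up_on T (ksum A k) m].

Lemma symbolic_powerE k : symbolic_power I k = monid (symbolic_monomials k).
Proof.
have hB v : ksum A k v -> forall l, (v l <= k * d)%N.
  by move=> kv l; rewrite -(ksum_mdeg A_deg kv) le_mdeg.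
rewrite /symbolic_power ideal_expE; apply/seteqP; split=> f hf.
  move=> m mf T aT; have := hf _ aT; rewrite /preimage /=.
  by move/(loc_ext_var_prime T f hB); apply.
move=> P aP; have [pP [g Eg]] := aP.
have [T ET] := colon_prime_var (@upset_up _ A) pP Eg.
rewrite /preimage /= ET; apply/(loc_ext_var_prime T f hB).
by move=> m mf; apply: (hf m mf); rewrite -ET.
Qed.

Hypothesis A_exch : exchange A.
Hypothesis I_unmixed : no_embedded_primes I.

(** Since the prime of [T] is minimal, for each [j] in [T] some [w] in [A]
    involves no variable of [T] except [x_j].  An exchange from an element of
    least degree on [T] towards this [w], at another coordinate of [T], cannot
    leave [T], so it moves a unit to [j].  With such moves, if [u] had larger
    degree on [T], an element of least degree could be brought below [u - e_i]
    on [T]; the sum [excess] of the amounts by which it is not below decreases. *)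
Lemma minimal_on_ass (T : {set 'I_n}) u i : Ass I (var_prime T) ->
  A u -> (0 < u i)%N -> ~ up_on T A (u - U_(i))%MM ->
  forall v, A v -> (deg_on T u <= deg_on T v)%N.
Proof.
move=> aT Au ui nup.
have pure j : j \in T -> exists2 w, A w & forall l, l \in T -> l != j -> w l = 0%N.
  move=> jT; apply: contrapT => h.
  have [] := @ass_exists (T :\ j) 0%MM.
    move=> [w Aw hw]; apply: h; exists w => // l lT lj.
    by apply/eqP; have := hw l; rewrite !inE lT lj mnm0E leqn0; apply.
  move=> T'' [sub aT'' _].
  have E : var_prime (K := K) T'' = var_prime T.
    apply: I_unmixed aT aT'' _ => a ha m /ha[l lT ml]; exists l => //.
    by move/fintype.subsetP: sub => /(_ l lT); rewrite !inE => /andP[].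
  have : var_prime T'' ('X_j : S).
    by rewrite E; apply/monidX; exists j; rewrite // mnm1E eqxx.
  move/monidX=> [l lT]; rewrite mnm1E; case: eqP => // jl _.
  by move/fintype.subsetP: sub => /(_ l lT); rewrite !inE jl eqxx.
have [c [[v0 [Av0 Ev0]] amin]] : exists c, (exists v, A v /\ deg_on T v = c) /\
   forall j, (exists v, A v /\ deg_on T v = j) -> (c <= j)%N.
  by apply: ex_min_nat; exists (deg_on T u), u.
suff ua : (deg_on T u <= c)%N.
  by move=> v Av; apply: leq_trans ua _; apply: amin; exists v.
rewrite leqNgt; apply/negP=> ua.
set f := (u - U_(i))%MM in nup.
have fa : (c <= deg_on T f)%N.
  have h : (U_(i) <= u)%MM by rewrite lep1mP -lt0n.
  have := congr1 (deg_on T) (submK h); rewrite deg_onD -/f.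
  have : (deg_on T U_(i) <= 1)%N.
    rewrite -(mdeg1 i) mdegE /deg_on [X in (_ <= X)%N](bigID (mem T)) /=.
    exact: leq_addr.
  by move: (deg_on T U_(i)) => x; lia.
pose excess v := (\sum_(l in T) (v l - f l))%N.
have [x [[v [Av Ev Ex]] xmin]] : exists x,
   (exists v, [/\ A v, deg_on T v = c & excess v = x]) /\
   forall j, (exists v, [/\ A v, deg_on T v = c & excess v = j]) -> (x <= j)%N.
  by apply: ex_min_nat; exists (excess v0), v0.
have [/existsP[l /andP[lT vl]]|] := boolP [exists l, (l \in T) && (f l < v l)%N];
    last first.
  rewrite negb_exists => /forallP h; apply: nup; exists v => // l lT.
  by have := h l; rewrite lT /= -leqNgt.
have [j jT vj] : exists2 j, j \in T & (v j < f j)%N.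
  apply: contrapT => h; move: fa; rewrite -Ev /deg_on leqNgt => /negP; apply.
  have le k : k \in T -> (f k <= v k)%N.
    by move=> kT; rewrite leqNgt; apply/negP=> vk; apply: h; exists k.
  rewrite (bigD1 l) //= [X in (_ < X)%N](bigD1 l) //= -addSn leq_add //.
  by apply: leq_sum => k /andP[/le].
have lj : l != j by apply/eqP=> E; move: vj; rewrite -E; lia.
have [w Aw hw] := pure j jT.
have [|m [vm Am]] := A_exch Av Aw (i := l); first by rewrite (hw _ lT lj); lia.
have lm : l != m by apply/eqP=> E; move: vm; rewrite -E (hw _ lT lj) ltn0.
have dv' : (deg_on T (v - U_(l) + U_(m))%MM + 1 = c + (m \in T))%N.
  have h : (U_(l) <= v)%MM by rewrite lep1mP; lia.
  have dU k : deg_on T U_(k)%MM = (k \in T).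
    have [kT|kT] := boolP (k \in T); last first.
      rewrite /deg_on big1 // => k' k'T; rewrite mnm1E; case: eqP => // E.
      by rewrite E k'T in kT.
    rewrite /deg_on (bigD1 k) //= mnm1E eqxx big1 // => k' /andP[_ ne].
    by rewrite mnm1E eq_sym (negbTE ne).
  have := congr1 (deg_on T) (submK h); rewrite !deg_onD Ev !dU lT /=; lia.
have mT : m \in T.
  apply/negPn/negP=> mT; rewrite (negbTE mT) in dv'.
  have := amin _ (ex_intro _ _ (conj Am (erefl _))); lia.
have mj : m = j.
  by apply/eqP/negPn/negP=> mj; move: vm; rewrite (hw _ mT mj) ltn0.
rewrite mj in Am dv'; rewrite jT in dv'.
have : (x <= excess (v - U_(l) + U_(j))%MM)%N.
  by apply: xmin; exists (v - U_(l) + U_(j))%MM; split=> //; lia.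
rewrite -Ex leqNgt => /negP; apply.
rewrite /excess (bigD1 l) //= [X in (_ < X)%N](bigD1 l) //= -addSn leq_add //.
  by rewrite mnmDE mnmBE !mnm1E eqxx (eq_sym j) (negbTE lj) /=; lia.
apply: leq_sum => k /andP[kT kl]; rewrite mnmDE mnmBE !mnm1E (eq_sym l) (negbTE kl).
by case: eqP => [<-|_]; lia.
Qed.

Lemma ksum_deg_on T k c V : (forall v, A v -> (c <= deg_on T v)%N) ->
  ksum A k V -> (k * c <= deg_on T V)%N.
Proof.
move=> h; elim: k V => [|k IH] V /=; first by rewrite mul0n.
by move=> [v [W [/h hv /IH hW ->]]]; rewrite deg_onD mulSn leq_add.
Qed.

(** On a suitable [T] containing [i], sums of [k] elements of [A] have degree at
    least that of [u *+ k] by [minimal_on_ass]. *)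
Lemma power_not_divisible k u i : A u -> (0 < u i)%N -> (0 < k)%N ->
  ~ symbolic_monomials k (u *+ k - U_(i))%MM.
Proof.
move=> Au ui k0 hs.
have [|T [_ aT nup]] := @ass_exists [set: 'I_n]%SET (u - U_(i))%MM.
  move=> [v Av hv].
  suff : (mdeg v <= mdeg (u - U_(i))%MM)%N.
    by rewrite -ltnS mdegBU // (A_deg Au) (A_deg Av) ltnn.
  by rewrite !mdegE; apply: leq_sum => l _; apply: hv; rewrite inE.
have iT : i \in T.
  apply/negPn/negP=> iT; apply: nup; exists u => // l lT.
  rewrite mnmBE mnm1E; case: eqP => [E|_]; last by rewrite subn0.
  by rewrite E lT in iT.
have umin := minimal_on_ass aT Au ui nup.
have [V kV hV] := hs T aT.
have := ksum_deg_on umin kV.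
have : (deg_on T V <= deg_on T (u *+ k - U_(i))%MM)%N by apply: leq_sum.
suff : (deg_on T (u *+ k - U_(i))%MM < k * deg_on T u)%N by lia.
rewrite /deg_on big_distrr /= (bigD1 i) //= [X in (_ < X)%N](bigD1 i) //=.
rewrite -addSn leq_add //.
  by rewrite mnmBE mulmnE mnm1E eqxx mulnC /=; have : (0 < k * u i)%N;
    rewrite ?muln_gt0 ?k0 //; lia.
by apply: leq_sum => l _; rewrite mnmBE mulmnE mulnC leq_subr.
Qed.

Lemma symbolic_monomials_upset k : upset (symbolic_monomials k).
Proof.
move=> m m' hm le T aT; apply: (cylinder_upset (@cylinder_up_on _ T (ksum A k))) le.
exact: hm.
Qed.

Lemma symbolic_monomials_power k u : A u -> symbolic_monomials k (u *+ k)%MM.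
Proof. by move=> Au T _; exists (u *+ k)%MM => //; exact: ksum_muln. Qed.

Lemma symbolic_monomials_capped k m l : symbolic_monomials k m ->
  (k * d < m l)%N -> symbolic_monomials k (m - U_(l))%MM.
Proof.
move=> hm ml T aT; have [V kV hV] := hm T aT; exists V => // i iT.
have := hV _ iT; rewrite mnmBE mnm1E; case: eqP => [<-|_]; last by rewrite subn0.
by have := le_mdeg V l; rewrite (ksum_mdeg A_deg kV); lia.
Qed.

End Localization.

(** * The Koszul complex and a contracting homotopy *)

Section Koszul.
Variables (K : fieldType) (n : nat).
Local Notation S := {mpoly K[n]}.
Implicit Types (A B M J : set 'X_{1..n}) (u v w m b : 'X_{1..n}) (f g p q a : S).
Implicit Types (i j l : 'I_n) (r s t : {set 'I_n}).

(** The sign of [i] in [i |: t] is [(-1) ^+ pos i t]. *)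
Definition pos i t := (\sum_(j in t) (j < i))%N.

Lemma posU1 i j t : i \notin t -> pos j (i |: t) = ((i < j) + pos j t)%N.
Proof. by move=> it; rewrite /pos big_setU1. Qed.

Lemma sign_swap (R : pzRingType) i j t : i != j -> i \notin t -> j \notin t ->
  (-1) ^+ pos i t * (-1) ^+ pos j (i |: t) =
    - ((-1) ^+ pos j t * (-1) ^+ pos i (j |: t)) :> R.
Proof.
move=> ij it jt; rewrite !posU1 // !exprD.
have /negbTE ne : (i : nat) != j by [].
have [lt|gt|E] := ltngtP i j; last by rewrite E eqxx in ne.
  by rewrite expr1 expr0 mul1r mulN1r mulrN -!exprD addnC.
by rewrite expr1 expr0 mul1r mulN1r mulrN opprK -!exprD addnC.
Qed.

Lemma antisym_sum (V : zmodType) (F : 'I_n -> 'I_n -> V) :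
  (forall i j, i != j -> F i j = - F j i) ->
  \sum_i \sum_(j | j != i) F i j = 0.
Proof.
move=> h.
pose G i j := if (i < j)%N then F i j else 0.
have -> : \sum_i \sum_(j | j != i) F i j = \sum_i \sum_j (G i j - G j i).
  apply: eq_bigr => i _; rewrite big_mkcond; apply: eq_bigr => j _.
  rewrite /G; have [lt|gt|E] := ltngtP i j.
  - by rewrite subr0; case: eqP => // E; rewrite E ltnn in lt.
  - rewrite sub0r; case: eqP => [E|/eqP ne]; first by rewrite E ltnn in gt.
    by rewrite h 1?eq_sym.
  by rewrite subr0 (val_inj E) eqxx.
rewrite (eq_bigr (fun i => \sum_j G i j - \sum_j G j i)); last first.
  by move=> i _; rewrite sumrB.
by rewrite sumrB [X in X - _]exchange_big subrr.
Qed.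

(** The Koszul differential on all degrees at once: [z t] is the coefficient of
    the wedge of the basis vectors in [t]. *)
Definition kos (V : lmodType S) (z : {set 'I_n} -> V) t : V :=
  \sum_(i | i \notin t) ((-1) ^+ pos i t * 'X_i) *: z (i |: t).

Lemma kos_kos (V : lmodType S) (z : {set 'I_n} -> V) t : kos (kos z) t = 0.
Proof.
pose F i j : V := if (i \notin t) && (j \notin t) then
  ((-1) ^+ pos i t * 'X_i * ((-1) ^+ pos j (i |: t) * 'X_j)) *: z (j |: (i |: t))
  else 0.
rewrite /kos (eq_bigr (fun i => \sum_(j | j != i) F i j)) => [|i it]; last first.
  rewrite scaler_sumr [RHS]big_mkcond [LHS]big_mkcond; apply: eq_bigr => j _.
  by rewrite /F it !inE negb_or; case: eqP => //= _; case: ifP; rewrite // scalerA.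
rewrite big_mkcond /= (eq_bigr (fun i => \sum_(j | j != i) F i j)) => [|i _].
  apply: antisym_sum => i j ij; rewrite /F andbC; case: ifP => [/andP[jt it]|_].
    rewrite -scaleNr finset.setUCA; congr (_ *: _).
    rewrite mulrACA sign_swap // mulNr; congr (- _).
    by rewrite [RHS]mulrACA ['X_i * _]mulrC.
  by rewrite oppr0.
by case: ifP => // it; rewrite big1 // => j _; rewrite /F it.
Qed.

Lemma kosB (V : lmodType S) (z y : {set 'I_n} -> V) t :
  kos (fun s => z s - y s) t = kos z t - kos y t.
Proof. by rewrite /kos -sumrB; apply: eq_bigr => i _; rewrite scalerBr. Qed.

Lemma kosD (V : lmodType S) (z y : {set 'I_n} -> V) t :
  kos (fun s => z s + y s) t = kos z t + kos y t.
Proof. by rewrite /kos -big_split; apply: eq_bigr => i _; rewrite scalerDr. Qed.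

Lemma mcoeff_sign k p m : (((-1) ^+ k * p : S)@_m) = (-1) ^+ k * p@_m.
Proof. by rewrite -signr_odd -[in RHS]signr_odd; case: odd; rewrite ?mulN1r ?mul1r ?mcoeffN. Qed.

Lemma mcoeff_kos (z : {set 'I_n} -> S^o) t m :
  (kos z t : S)@_m = \sum_(i | i \notin t)
    (-1) ^+ pos i t * (if (0 < m i)%N then (z (i |: t) : S)@_(m - U_(i)) else 0).
Proof.
rewrite /kos raddf_sum /=; apply: eq_bigr => i _.
by rewrite -mcoeffMXi -mcoeff_sign (mulrC (z _ : S)) mulrA.
Qed.

Lemma monid_kos M (y : {set 'I_n} -> S^o) t : upset M ->
  (forall s, monid M (y s)) -> monid M (kos y t).
Proof. by move=> uM h; apply: monid_sum => i _; apply: monidM. Qed.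

(** The multidegree of the basis vector [t]; the differential preserves the
    multidegree [m + ind t] of a term [x^m] at [t]. *)
Definition ind t : 'X_{1..n} := [multinom (i \in t : nat) | i < n].

Lemma indE t i : ind t i = (i \in t).
Proof. exact: mnmE. Qed.

Lemma ind_move m i t : i \notin t -> (0 < m i)%N ->
  (m - U_(i) + ind (i |: t) = m + ind t)%MM.
Proof.
move=> it mi; apply/mnmP=> j; rewrite !(mnmDE, mnmBE, mnm1E, mnmE) !inE eq_sym.
by case: eqP => [->|_] /=; rewrite ?subn0 // (negbTE it); lia.
Qed.

Lemma mcoeff_bounded_sum (E : 'X_{1..n} -> K) N :
  (forall m, (N <= mdeg m)%N -> E m = 0) ->
  forall m, (\sum_(m : 'X_{1..n < N}) E m *: 'X_[m] : S)@_m = E m.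
Proof.
move=> h m; have [le|lt] := leqP N (mdeg m); last exact: mcoeff_mpoly.
rewrite h // raddf_sum big1 //= => m' _; rewrite mcoeffZ mcoeffX.
case: eqP => [Em|_]; last by rewrite mulr0.
by have := bmdeg m'; rewrite Em ltnNge le.
Qed.

(** A contracting homotopy modulo a smaller monomial ideal [J'].  In each
    multidegree [b] choose a variable [l = sel b].  The hypothesis on [sel] says
    that the faces [t] with [x^(b - ind t)] in [J] and outside [J'] are stable
    under adding or removing [l], so that wedging with the basis vector [l] and
    dividing by [x_l] contracts the Koszul complex of [J] modulo [J'] in that
    multidegree. *)
Lemma koszul_contraction J J' (sel : 'X_{1..n} -> option 'I_n) (z : {set 'I_n} -> S^o) :
  upset J -> upset J' ->
  (forall m t l, J m -> ~ J' m -> sel (m + ind t)%MM = Some l ->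
    if l \in t then ~ J' (m + U_(l))%MM else (0 < m l)%N /\ J (m - U_(l))%MM) ->
  (forall t, monid J (z t)) ->
  (forall t m, m \in msupp (z t) -> ~ J' m -> sel (m + ind t)%MM <> None) ->
  (forall t, kos z t = 0) ->
  exists y : {set 'I_n} -> S^o, [/\ forall t, monid J (y t),
    forall t m, m \in msupp (y t) ->
      exists r l, (m + U_(l))%MM \in msupp (z r : S) &
    forall t, monid J' (z t - kos y t : S)].
Proof.
move=> uJ uJ' selP zJ zsel zcyc.
pose c t m : K := if `[< J m /\ ~ J' m >] then
    if sel (m + ind t)%MM is Some l then
      if l \in t then (-1) ^+ pos l (t :\ l) * (z (t :\ l) : S)@_(m + U_(l))
      else 0
    else 0
  else 0.
pose N := (\sum_t msize (z t : S))%N.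
have cnz t m : c t m != 0 -> [/\ J m, ~ J' m & exists r l, (m + U_(l))%MM \in msupp (z r : S)].
  rewrite /c; case: ifP => [/asboolP[? ?]|_]; last by rewrite eqxx.
  case: (sel _) => [l|]; last by rewrite eqxx.
  case: ifP => _; last by rewrite eqxx.
  by rewrite mulf_eq0 signr_eq0 /= -mcoeff_msupp => h; split=> //; exists (t :\ l), l.
have cN t m : (N <= mdeg m)%N -> c t m = 0.
  move=> le; apply/eqP/negPn/negP=> /cnz[_ _ [r [l /msize_mdeg_lt]]].
  rewrite mdegD mdeg1 addn1 => lt; suff : (msize (z r : S) <= N)%N by lia.
  by rewrite /N (bigD1 r) //= leq_addr.
pose y t : S^o := \sum_(m : 'X_{1..n < N}) c t m *: ('X_[m] : S).
have yE t m : (y t : S)@_m = c t m by apply: mcoeff_bounded_sum; exact: cN.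
exists y; split=> [t m|t m|t m].
- by rewrite mcoeff_msupp yE => /cnz[].
- by rewrite mcoeff_msupp yE => /cnz[].
rewrite mcoeff_msupp mcoeffB subr_eq0 => ne; apply: contrapT => nJ'm.
move/eqP: ne; apply.
have [Jm|nJm] := EM (J m); last first.
  have kJ : monid J (kos y t).
    by apply: monid_kos => // s m'; rewrite mcoeff_msupp yE => /cnz[].
  rewrite !memN_msupp_eq0 //; apply/negP; first by move/kJ.
  by move/zJ.
have nJ'i i : ~ J' (m - U_(i))%MM.
  by move=> h; apply: nJ'm; apply: uJ' h _; exact: lem_subr.
rewrite mcoeff_kos.
have cE i : i \notin t -> (0 < m i)%N -> c (i |: t) (m - U_(i))%MM =
   if `[< J (m - U_(i))%MM >] then
    if sel (m + ind t)%MM is Some l then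
      if l \in i |: t then (-1) ^+ pos l ((i |: t) :\ l) *
        (z ((i |: t) :\ l) : S)@_(m - U_(i) + U_(l))
      else 0
    else 0
  else 0.
  move=> it mi; rewrite /c ind_move //; congr (if _ then _ else _).
  by apply: asbool_equiv_eq; split=> [[]|].
case Esel : (sel (m + ind t)%MM) => [l|]; last first.
  rewrite big1 => [|i it]; last first.
    by rewrite yE; case: ifP => mi; rewrite ?mulr0 // cE // Esel if_same mulr0.
  apply: memN_msupp_eq0; apply/negP=> h; exact: zsel h nJ'm Esel.
have := selP _ _ _ Jm nJ'm Esel.
have [lt nJ'l|lt [ml Jl]] := boolP (l \in t); last first.
  (* the variable l is absent from t: only the face l |: t contributes *)
  rewrite (bigD1 l) //= yE ml cE // Esel finset.setU11 asboolT // finset.setU1K //.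
  rewrite submK ?lep1mP -?lt0n // mulrA -expr2 sqrr_sign mul1r big1 ?addr0 //.
  move=> i /andP[it il]; rewrite yE; case: ifP => mi; rewrite ?mulr0 // cE // Esel.
  by rewrite !inE (negbTE lt) eq_sym (negbTE il) /= if_same mulr0.
(* the variable l is in t: use the cycle condition at t :\ l *)
pose r := t :\ l; have lr : l \notin r by rewrite !inE eqxx.
have tE : l |: r = t by rewrite finset.setD1K.
clearbody r.
have := congr1 (fun p : S => p@_(m + U_(l))) (zcyc r).
rewrite mcoeff0 mcoeff_kos (bigD1 l) //= mnmDE mnm1E eqxx addn1 addmK tE /=.
move/eqP; rewrite addr_eq0 => /eqP E.
have -> : (z t : S)@_m = (-1) ^+ pos l r * ((-1) ^+ pos l r * (z t : S)@_m).
  by rewrite mulrA -expr2 sqrr_sign mul1r.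
rewrite E mulrN mulr_sumr -sumrN; apply: eq_big => [i|i].
  by rewrite -tE !inE negb_or andbC.
move=> /andP[ir il].
have it : i \notin t by rewrite -tE !inE negb_or il ir.
have mE : (m + U_(l))%MM i = m i by rewrite mnmDE mnm1E eq_sym (negbTE il) addn0.
rewrite yE mE; case: ifP => mi; last by rewrite !mulr0 oppr0.
have sE : (i |: t) :\ l = i |: r.
  apply/finset.setP=> k; rewrite -tE !inE; have [->|_] := eqVneq k l; last by [].
  by rewrite /= (eq_sym l) (negbTE il) (negbTE lr).
have dE : (m + U_(l) - U_(i) = m - U_(i) + U_(l))%MM.
  apply/mnmP=> k; rewrite !(mnmDE, mnmBE, mnm1E).
  by have [<-|_] := eqVneq i k; [lia|rewrite !subn0].
rewrite cE // Esel sE dE; have -> : l \in i |: t by rewrite inE lt orbT.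
case: asboolP => [_|nJi].
  rewrite mulrA (_ : (-1) ^+ pos i t * (-1) ^+ pos l (i |: r) =
     - ((-1) ^+ pos l r * (-1) ^+ pos i r)); last first.
    have := @sign_swap K i l r il ir lr; rewrite tE => sw.
    have sq k : ((-1) ^+ k * (-1) ^+ k = 1 :> K) by rewrite -expr2 sqrr_sign.
    have aux (e1 e2 e3 e4 : K) : e1 * e1 = 1 -> e4 * e4 = 1 ->
        e1 * e2 = - (e3 * e4) -> e4 * e2 = - (e3 * e1).
      move=> e11 e44 E'; have -> : e4 * e2 = e4 * e1 * (e1 * e2).
        by rewrite mulrA -(mulrA e4) e11 mulr1.
      by rewrite E' -[e3 in RHS]mul1r -e44; ring.
    exact: aux (sq _) (sq _) sw.
  by rewrite mulNr mulrA.
rewrite mulr0 [X in - X](_ : _ = 0) ?oppr0 //.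
rewrite memN_msupp_eq0 ?mulr0 //; apply/negP=> h.
have J2 := zJ _ _ h; have nJ2 : ~ J' (m - U_(i) + U_(l))%MM.
  move=> h2; apply: nJ'l; apply: uJ' h2 _; rewrite -dE; exact: lem_subr.
have Eb : (m - U_(i) + U_(l) + ind (i |: r) = m + ind t)%MM.
  rewrite -dE ind_move ?mE // -tE; apply/mnmP=> k.
  rewrite !(mnmDE, mnm1E, mnmE) !inE eq_sym.
  by have [->|_] := eqVneq k l; rewrite ?eqxx ?addn0 //; lia.
have := selP _ (i |: r) l J2 nJ2; rewrite Eb => /(_ Esel).
have /negbTE -> : l \notin i |: r by rewrite !inE negb_or eq_sym il lr.
by rewrite addmK => -[].
Qed.

End Koszul.

(** * Koszul acyclicity in high degrees *)

Section KoszulVanishing.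
Variables (K : fieldType) (n : nat).
Local Notation S := {mpoly K[n]}.
Implicit Types (A B M J : set 'X_{1..n}) (u v w m b : 'X_{1..n}).
Implicit Types (i j l : 'I_n) (r t : {set 'I_n}).

(** Koszul homology of the ideal vanishes where coefficients have degree greater
    than [e]; for an ideal this says that its regularity is at most [e]. *)
Definition koszul_vanishing M e := forall z : {set 'I_n} -> S^o,
  (forall t, monid M (z t)) ->
  (forall t m, m \in msupp (z t) -> (e < mdeg m)%N) ->
  (forall t, kos z t = 0) ->
  exists y : {set 'I_n} -> S^o, (forall t, monid M (y t)) /\
    forall t, kos y t = z t.

Lemma monid_set0 (f : S) : monid set0 f -> f = 0.
Proof.
move=> h; apply: msuppnil0; case E : (msupp f) => [//|m s].
by case: (h m); rewrite E inE eqxx.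
Qed.

Lemma set0_upset : upset (set0 : set 'X_{1..n}).
Proof. by []. Qed.

Lemma pick_threshold N m : (n * N < mdeg m)%N -> exists l, (N < m l)%N.
Proof.
move=> h; apply: contrapT => hl; move: h; rewrite ltnNge => /negP; apply.
rewrite mdegE -[X in (X * _)%N]card_ord -sum_nat_const; apply: leq_sum => l _.
by rewrite leqNgt; apply/negP=> lN; apply: hl; exists l.
Qed.

(** In a multidegree with an exponent above [N], multiplication and division by
    that variable do not change membership in [M], so the faces form a cone. *)
Lemma capped_vanishing M N : upset M ->
  (forall m l, M m -> (N < m l)%N -> M (m - U_(l))%MM) ->
  koszul_vanishing M (n * N).
Proof.
move=> uM cap z zM zdeg zc.
have [||y [yM _ yz]] := @koszul_contraction K n M set0
  (fun b => [pick l : 'I_n | (N < b l)%N]) z uM set0_upset _ zM _ zc.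
- move=> m t l Mm _; case: pickP => // k; rewrite mnmDE indE => hk [<-].
  case: ifP => [_ []|kt]; rewrite kt /= addn0 in hk.
  by split; [exact: leq_ltn_trans hk|exact: cap].
- move=> t m ms _; case: pickP => // hno _.
  have [l] := pick_threshold (zdeg _ _ ms).
  by have := hno l; rewrite mnmDE indE => /negbT; rewrite -leqNgt; lia.
exists y; split=> // t; have /monid_set0/eqP := yz t.
by rewrite subr_eq0 => /eqP.
Qed.

Lemma free_koszul_exact (z : {set 'I_n} -> S^o) :
  (z finset.set0 : S)@_0%MM = 0 -> (forall t, kos z t = 0) ->
  exists y : {set 'I_n} -> S^o, (forall t, kos y t = z t) /\
    forall t m, m \in msupp (y t) ->
      exists r l, (m + U_(l))%MM \in msupp (z r : S).
Proof.
move=> z0 zc.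
have [|//|||y [_ ydeg yz]] := @koszul_contraction K n setT set0
  (fun b => [pick l : 'I_n | (0 < b l)%N]) z _ set0_upset _ _ _ zc.
- by [].
- move=> m t l _ _; case: pickP => // k; rewrite mnmDE indE => hk [<-].
  by case: ifP => [_ []|kt]; rewrite kt /= addn0 in hk.
- by [].
- move=> t m ms _; case: pickP => // hno _.
  have {}hno k : m k = 0%N /\ (k \in t) = false.
    by have := hno k; rewrite mnmDE indE; case: (k \in t) => /=; lia.
  have E : t = finset.set0 by apply/finset.setP=> k; rewrite inE (hno k).2.
  have Em : m = 0%MM by apply/mnmP=> k; rewrite mnm0E (hno k).1.
  by move: ms; rewrite E Em mcoeff_msupp z0 eqxx.
exists y; split=> // t; have /monid_set0/eqP := yz t.
by rewrite subr_eq0 => /eqP.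
Qed.

Definition linear_quotients (s : seq 'X_{1..n}) :=
  forall u v, u \in s -> v \in s -> (v < u)%O ->
  exists i l, [/\ (u l < v l)%N, (u - U_(i) + U_(l))%MM \in s &
    ((u - U_(i) + U_(l))%MM < u)%O].

(** Adding the last generator [u] adds the monomials [x^u w] with [w] free of the
    variables [T] that generate the colon ideal of the earlier generators by
    [x^u].  If the degree of [x^u w] exceeds [d], then [w] involves a variable
    off [T], and this variable contracts the new layer. *)
Lemma linear_quotients_vanishing (s : seq 'X_{1..n}) d :
  pairwise <%O s -> (forall u, u \in s -> mdeg u = d) -> linear_quotients s ->
  koszul_vanishing (up [set m | m \in s]) d.
Proof.
elim/last_ind: s => [|s u IH] sorts degs lqs z zM zdeg zc.
  exists (fun=> 0); split=> t; first exact: monid0.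
  have -> : z t = 0 by apply: monid_set0 => m /(zM t)[v]; rewrite /= inE.
  by rewrite /kos big1 // => i _; rewrite scaler0.
move: sorts; rewrite pairwise_rcons => /andP[/allP/= ltu sorts].
have degs' v : v \in s -> mdeg v = d by move=> vs; apply: degs; rewrite mem_rcons inE vs orbT.
have lqs' : linear_quotients s.
  move=> v w vs ws wv; have [||i [l [h1 h2 h3]]] := lqs v w _ _ wv.
  - by rewrite mem_rcons inE vs orbT.
  - by rewrite mem_rcons inE ws orbT.
  exists i, l; split=> //; move: h2; rewrite mem_rcons inE => /orP[/eqP E|//].
  by have := lt_trans h3 (ltu _ vs); rewrite E ltxx.
have us : u \in rcons s u by rewrite mem_rcons inE eqxx.
pose J : set 'X_{1..n} := up [set m | m \in rcons s u].
pose J' : set 'X_{1..n} := up [set m | m \in s].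
pose T l := `[< J' (u + U_(l))%MM >].
have JP m : J m -> ~ J' m -> (u <= m)%MM.
  move=> [v]; rewrite /= mem_rcons inE => /orP[/eqP -> //|vs vm] nJ.
  by case: nJ; exists v.
(* linear quotients say that the colon ideal of J' by u is generated by T *)
have layer m : (u <= m)%MM -> J' m <-> exists2 l, T l & (u l < m l)%N.
  move=> um; split; last first.
    move=> [l /asboolP Tl ul]; apply: upset_up Tl _; apply/mnm_lepP=> k.
    rewrite mnmDE mnm1E; move/mnm_lepP: um => /(_ k).
    by case: eqP => [<-|_]; lia.
  move=> [v vs vm]; have vin : v \in rcons s u by rewrite mem_rcons inE vs orbT.
  have [i [l [ul ws lt]]] := lqs u v us vin (ltu _ vs).
  exists l; last by move/mnm_lepP: vm => /(_ l); lia.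
  apply/asboolP; exists (u - U_(i) + U_(l))%MM.
    move: ws; rewrite mem_rcons inE => /orP[/eqP E|//].
    by rewrite {1}E ltxx in lt.
  by apply/mnm_lepP=> k; rewrite !(mnmDE, mnmBE) leq_add2r leq_subr.
have [||||y [yJ ydeg yz]] := @koszul_contraction K n J J'
  (fun b => [pick l : 'I_n | ~~ T l && (u l < b l)%N]) z _ _ _ zM _ zc.
- exact: upset_up.
- exact: upset_up.
- move=> m t l Jm nJm; case: pickP => // k /andP[nT]; rewrite mnmDE indE => hk [<-].
  have um := JP _ Jm nJm.
  case: ifP => kt.
    have um' : (u <= m + U_(k))%MM by apply: lepm_trans um _; exact: lem_addr.
    move/(layer _ um') => [j Tj]; rewrite mnmDE mnm1E; case: eqP => [E|_] uj.
      by rewrite E Tj in nT.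
    by apply: nJm; apply/(layer _ um); exists j => //; lia.
  rewrite kt /= addn0 in hk; split; first exact: leq_ltn_trans hk.
  exists u => //; apply/mnm_lepP=> j; rewrite mnmBE mnm1E.
  move/mnm_lepP: um => /(_ j).
  by case: eqP => [<-|_]; lia.
- move=> t m ms nJm; have um := JP _ (zM _ _ ms) nJm.
  case: pickP => // hno _.
  have := zdeg _ _ ms; rewrite -(degs u us) ltnNge => /negP; apply.
  rewrite !mdegE; apply: leq_sum => l _; rewrite leqNgt; apply/negP=> ul.
  have := hno l; rewrite mnmDE (leq_trans ul) ?leq_addr // andbT => /negbFE Tl.
  by apply: nJm; apply/(layer _ um); exists l.
have [||y' [y'J y'z]] := IH sorts degs' lqs' (fun t => z t - kos y t) yz.
- move=> t m /msuppB_le; rewrite mem_cat => /orP[/zdeg//|].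
  rewrite mcoeff_msupp mcoeff_kos => h; apply: contrapT => /negP; rewrite -leqNgt => le.
  move/eqP: h; apply; apply: big1 => i _; case: ifP => mi; rewrite ?mulr0 //.
  rewrite memN_msupp_eq0 ?mulr0 //; apply/negP=> /ydeg[r [l /zdeg]].
  by rewrite mdegD mdeg1 addn1 mdegBU // ltnNge le.
- by move=> t; rewrite kosB zc kos_kos subr0.
exists (fun t => y t + y' t); split=> t; last by rewrite kosD y'z addrC subrK.
apply: monidD; first exact: yJ.
move=> m /(y'J t)[v vs vm]; exists v => //=; by rewrite mem_rcons inE vs orbT.
Qed.

(** If [v] is lexicographically smaller than [u], the exchange at the first
    coordinate where they differ makes [u] smaller, which is what linear
    quotients in the lexicographic order ask for. *)
Lemma exchange_vanishing A d : (forall u, A u -> mdeg u = d) -> exchange A ->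
  koszul_vanishing (up A) d.
Proof.
move=> degA exA.
pose s := sort <=%O [seq bmnm x | x <- enum {: 'X_{1..n < d.+1}} & `[< A (bmnm x) >]].
have sA m : m \in s <-> A m.
  rewrite mem_sort; split.
    by move=> /mapP[m']; rewrite mem_filter => /andP[/asboolP Am _] ->.
  move=> Am; have lt : (mdeg m < d.+1)%N by rewrite (degA _ Am).
  apply/mapP; exists (BMultinom lt) => //.
  by rewrite mem_filter mem_enum /= andbT; apply/asboolP.
have -> : A = [set m | m \in s].
  by apply/seteqP; split=> m /sA.
apply: linear_quotients_vanishing.
- rewrite -sorted_pairwise; last exact: lt_trans.
  rewrite lt_sorted_uniq_le sort_uniq sort_sorted ?andbT; last exact: le_total.
  rewrite map_inj_uniq; first by rewrite filter_uniq ?enum_uniq.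
  by move=> x y E; apply: val_inj.
- by move=> u /sA/degA.
move=> u v /sA Au /sA Av.
have dvu : mdeg v = mdeg u by rewrite !degA.
move/(ltmcP dvu) => [i eqi lti].
have [j [uj Aj]] := exA _ _ Au Av _ lti.
exists i, j; split=> //; first exact/sA.
apply/ltmcP; first by rewrite !degA.
have ij : i != j by apply/eqP=> E; rewrite -E in uj; lia.
have ltij : (i < j)%N.
  rewrite ltnNge leq_eqVlt negb_or eq_sym ij /=; apply/negP=> ji.
  by rewrite (eqi _ ji) ltnn in uj.
exists i => [k ki|]; rewrite mnmDE mnmBE !mnm1E.
  have /negbTE -> : i != k by rewrite neq_ltn ki orbT.
  have /negbTE -> : j != k by rewrite neq_ltn (ltn_trans ki ltij) orbT.
  by rewrite subn0 addn0.
by rewrite eqxx eq_sym (negbTE ij) /= addn0; lia.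
Qed.

End KoszulVanishing.

(** * Passing to syzygies *)

Section GradedModules.
Variables (K : fieldType) (n : nat).
Local Notation S := {mpoly K[n]}.
Implicit Types (i j l : 'I_n) (s t : {set 'I_n}) (m : 'X_{1..n}) (p f g : S).

Lemma homog_diffP d e p :
  homog_diff d e p <-> forall m, m \in msupp p -> (mdeg m + e)%N = d.
Proof.
rewrite /homog_diff; case: leqP => h; split.
- by move/dhomogP=> hp m ms; rewrite (hp m ms : mdeg m = _) subnK.
- move=> hp; apply/dhomogP=> m ms; rewrite -(hp m ms) addnK; exact: erefl.
- by move=> -> m; rewrite -[0]/(0%:MP) msupp0.
move=> hp; apply: msuppnil0; case E : (msupp p) => [//|m s].
by have := hp m; rewrite E inE eqxx => /(_ isT); lia.
Qed.

Definition homog_mx r q (degr : 'I_r -> nat) (degq : 'I_q -> nat)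
  (A : 'M[S]_(r, q)) := forall a b, homog_diff (degr a) (degq b) (A a b).

Definition ord_ge q (deg : 'I_q -> nat) e (v : 'rV[S]_q) :=
  forall b m, m \in msupp (v 0 b) -> (e <= mdeg m + deg b)%N.

Definition homog_row q (deg : 'I_q -> nat) d (v : 'rV[S]_q) :=
  forall b m, m \in msupp (v 0 b) -> (mdeg m + deg b)%N = d.

Definition row_vanishing q (deg : 'I_q -> nat) (N : set 'rV[S]_q) e :=
  forall z : {set 'I_n} -> 'rV[S]_q,
  (forall t, N (z t)) -> (forall t, ord_ge deg e.+1 (z t)) ->
  (forall t, kos z t = 0) ->
  exists y, (forall t, N (y t)) /\ forall t, kos y t = z t.

Definition row_kernel r q (A : 'M[S]_(r, q)) : set 'rV[S]_r :=
  [set v | v *m A = 0].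

Definition row_image r q (A : 'M[S]_(r, q)) : set 'rV[S]_q :=
  [set w | exists v, w = v *m A].

Definition in_max_ideal r (Z : set 'rV[S]_r) :=
  forall v, Z v -> forall a, (v 0 a)@_0%MM = 0.

Definition ideal_rows (J : set S) : set 'rV[S]_1 := [set w | J (w 0 0)].

Lemma kosE q (z : {set 'I_n} -> 'rV[S]_q) t b :
  (kos z t) 0 b = kos (fun s => z s 0 b : S^o) t.
Proof. by rewrite /kos summxE; apply: eq_bigr => i _; rewrite mxE. Qed.

Lemma kos_mulmx r q (A : 'M[S]_(r, q)) (z : {set 'I_n} -> 'rV[S]_r) t :
  kos z t *m A = kos (fun s => z s *m A) t.
Proof. by rewrite /kos mulmx_suml; apply: eq_bigr => i _; rewrite scalemxAl. Qed.

Lemma ideal_rows_vanishing (M : set 'X_{1..n}) e : koszul_vanishing K M e ->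
  row_vanishing (fun=> 0%N) (ideal_rows (monid M)) e.
Proof.
move=> hM z zM zdeg zc.
have [|||y [yM yz]] := hM (fun t => z t 0 0).
- exact: zM.
- by move=> t m /zdeg; rewrite addn0.
- by move=> t; rewrite -(kosE z t 0) zc mxE.
exists (fun t => const_mx (y t)); split=> t; first by rewrite /ideal_rows /= mxE.
apply/rowP=> b; rewrite ord1 kosE -yz; apply: eq_bigr => i _.
by rewrite mxE.
Qed.

Lemma ord_ge_mulmx r q degr degq (A : 'M[S]_(r, q)) e v :
  homog_mx degr degq A -> ord_ge degr e v -> ord_ge degq e (v *m A).
Proof.
move=> hA hv b m; rewrite mcoeff_msupp mxE raddf_sum /= => h.
have [a ha] : exists a, (v 0 a * A a b)@_m != 0.
  apply: contrapT => no; move/eqP: h; apply; apply: big1 => a _.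
  by apply/eqP/negPn/negP=> ?; apply: no; exists a.
move: ha; rewrite -mcoeff_msupp => /msuppM_le /allpairsP[[m1 m2] /= [h1 h2 ->]].
have /homog_diffP/(_ _ h2) E := hA a b.
by rewrite mdegD -addnA E; exact: hv.
Qed.

(** A cycle [z] with coefficients in the kernel is the boundary of some [Y] in
    the free module, whose Koszul complex is exact because [z] has no constant
    terms.  The image of [Y] is a cycle, hence the boundary of the image of some
    [u], and [Y - kos u] has coefficients in the kernel and boundary [z]. *)
Lemma vanishing_shift r q degr degq (A : 'M[S]_(r, q)) e :
  homog_mx degr degq A -> in_max_ideal (row_kernel A) ->
  row_vanishing degq (row_image A) e ->
  row_vanishing degr (row_kernel A) e.+1.
Proof.
move=> hA kerm van z zk zdeg zc.
have /choice[y yP] : forall a, exists y : {set 'I_n} -> S^o,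
    (forall t, kos y t = z t 0 a) /\
    forall t m, m \in msupp (y t) ->
      exists r l, (m + U_(l))%MM \in msupp (z r 0 a).
  move=> a; apply: (@free_koszul_exact _ _ (fun t => z t 0 a)).
    exact: kerm.
  by move=> t; rewrite -kosE zc mxE.
pose Y t : 'rV[S]_r := \row_a y a t.
have kY t : kos Y t = z t.
  apply/rowP=> a; rewrite kosE -(proj1 (yP a)); apply: eq_bigr => i _.
  by rewrite mxE.
have Ydeg t : ord_ge degr e.+1 (Y t).
  move=> a m; rewrite mxE => /(proj2 (yP a))[r' [l /zdeg]].
  by rewrite mdegD mdeg1 addn1 addSn ltnS.
have [|||w [wN wY]] := van (fun t => Y t *m A).
- by move=> t; exists (Y t).
- by move=> t; apply: ord_ge_mulmx hA _.
- by move=> t; rewrite -kos_mulmx kY; exact: zk.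
have /choice[u uP] := wN.
exists (fun t => Y t - kos u t); split=> t; last by rewrite kosB kY kos_kos subr0.
rewrite /row_kernel /= mulmxBl kos_mulmx -wY; apply/eqP; rewrite subr_eq0; apply/eqP.
by apply: eq_bigr => i _; rewrite -uP.
Qed.

(** An element is a Koszul cycle supported on the empty set; that it is a
    boundary means that it is a combination of elements of [N] with variables
    as coefficients. *)
Lemma nakayama_kos q deg (N : set 'rV[S]_q) e v : N 0 ->
  row_vanishing deg N e -> N v -> ord_ge deg e.+1 v ->
  exists y : 'I_n -> 'rV[S]_q, (forall i, N (y i)) /\
    v = \sum_i 'X_i *: y i.
Proof.
move=> N0 van Nv vdeg.
have [t|t|t|y [yN yz]] := van (fun t => if t == finset.set0 then v else 0).
- by case: ifP.
- by case: ifP => // _ b m; rewrite mxE -[0]/(0%:MP) msupp0.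
- rewrite /kos big1 // => i _; case: ifP => [/eqP E|]; last by rewrite scaler0.
  by have := finset.setU11 i t; rewrite E inE.
exists (fun i => y (i |: finset.set0)); split=> //.
have := yz finset.set0; rewrite eqxx => <-.
apply: eq_big => [i|i _]; first by rewrite inE.
by rewrite /pos big_set0 expr0 mul1r.
Qed.

(** A generator of degree above [e] would be a combination of the others, and of
    itself, with coefficients without constant term, so a relation would have
    constant term 1. *)
Lemma generator_bound r q degr degq (A : 'M[S]_(r, q)) e :
  homog_mx degr degq A -> in_max_ideal (row_kernel A) ->
  row_vanishing degq (row_image A) e -> forall a, (degr a <= e)%N.
Proof.
move=> hA kerm van a; rewrite leqNgt; apply/negP=> lt.
have [|||y [yN yE]] := @nakayama_kos _ degq (row_image A) e (row a A) _ van.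
- by exists 0; rewrite mul0mx.
- by exists (delta_mx 0 a); rewrite -rowE.
- move=> b m; rewrite mxE => ms; have /homog_diffP/(_ m ms) := hA a b; lia.
have /choice[u uP] := yN.
have /kerm/(_ a) : row_kernel A (delta_mx 0 a - \sum_i 'X_i *: u i).
  rewrite /row_kernel /= mulmxBl -rowE; apply/eqP; rewrite subr_eq0; apply/eqP.
  by rewrite yE mulmx_suml; apply: eq_bigr => i _; rewrite -scalemxAl -uP.
rewrite !mxE !eqxx mcoeffB mcoeff1 eqxx summxE raddf_sum big1 /=.
  by rewrite subr0 => /eqP; rewrite oner_eq0.
by move=> i _; rewrite mxE mulrC mcoeffMXi mnm0E.
Qed.

End GradedModules.

(** * Degrees in a minimal free resolution *)

Section RegularityBound.
Variables (K : fieldType) (n : nat).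
Local Notation S := {mpoly K[n]}.

Lemma resolution_degree_bound (M : set 'X_{1..n}) e (F : min_free_res (monid M : set S)) :
  koszul_vanishing K M e -> forall i (a : 'I_(mfr_rk F i)), (mfr_deg a <= e + i)%N.
Proof.
move=> van.
have augE : row_image (mfr_aug F) = ideal_rows (monid M).
  apply/seteqP; split=> w.
    by move=> [v ->]; apply/(mfr_aug_im F); exists v.
  move/(mfr_aug_im F) => [v vw]; exists v; apply/rowP=> b.
  by rewrite ord1 vw.
have ker0 : row_kernel (mfr_aug F) = row_image (mfr_d F 0).
  by apply/seteqP; split=> v /mfr_exact0.
have kerS i : row_kernel (mfr_d F i) = row_image (mfr_d F i.+1).
  by apply/seteqP; split=> v /mfr_exactS.
have minI i : in_max_ideal (row_image (mfr_d F i)).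
  move=> _ [w ->] a; rewrite mxE raddf_sum big1 //= => b _.
  by rewrite rmorphM /= mfr_minimal mulr0.
have aug_homog : homog_mx (@mfr_deg _ _ _ F 0) (fun=> 0%N) (mfr_aug F).
  by move=> a b; rewrite ord1 /homog_diff subn0; exact: mfr_aug_homog.
have van0 := ideal_rows_vanishing van.
have vanS i : row_vanishing (@mfr_deg _ _ _ F i) (row_image (mfr_d F i)) (e + i).+1.
  elim: i => [|i IH].
    rewrite addn0 -ker0; apply: (vanishing_shift aug_homog); last by rewrite augE.
    by rewrite ker0.
  rewrite addnS -kerS; apply: (vanishing_shift _ _ IH); last by rewrite kerS.
  exact: mfr_d_homog.
case=> [|i] a.
  rewrite addn0; apply: (generator_bound aug_homog); last by rewrite augE.
  by rewrite ker0.
rewrite addnS; apply: (generator_bound _ _ (vanS i)); last by rewrite kerS.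
exact: mfr_d_homog.
Qed.

(** Some homogeneous generator has a monomial dividing [x^m], which must be [x^m]
    itself by minimality. *)
Lemma minimal_monomial_degree (M : set 'X_{1..n}) (F : min_free_res (monid M : set S)) m :
  M m -> (forall i : 'I_n, (0 < m i)%N -> ~ M (m - U_(i))%MM) -> upset M ->
  exists a : 'I_(mfr_rk F 0), mfr_deg a = mdeg m.
Proof.
move=> Mm mmin uM.
have [v vE] : exists v : 'rV_(mfr_rk F 0), (v *m mfr_aug F) 0 0 = 'X_[m].
  by apply/(mfr_aug_im F)/monidX.
have : ((v *m mfr_aug F) 0 0)@_m != 0 by rewrite vE mcoeffX eqxx oner_eq0.
rewrite mxE raddf_sum /= => h.
have [a ha] : exists a, (v 0 a * mfr_aug F a 0)@_m != 0.
  apply: contrapT => no; move/eqP: h; apply; apply: big1 => a _.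
  by apply/eqP/negPn/negP=> ?; apply: no; exists a.
move: ha; rewrite -mcoeff_msupp => /msuppM_le /allpairsP[[m1 m2] /= [_ h2 E]].
have Mm2 : M m2.
  have : monid M (mfr_aug F a 0).
    apply/(mfr_aug_im F); exists (delta_mx 0 a).
    by rewrite -rowE mxE.
  by move=> /(_ _ h2).
have m10 : m1 = 0%MM.
  apply/mnmP=> i; rewrite mnm0E; apply/eqP; rewrite -leqn0 leqNgt; apply/negP=> m1i.
  have mi : (0 < m i)%N by rewrite E mnmDE; lia.
  apply: (mmin i mi); apply: uM Mm2 _; apply/mnm_lepP=> j.
  rewrite E mnmBE mnmDE mnm1E; case: eqP => [<-|_]; lia.
exists a; rewrite E m10 add0m.
by have /dhomogP/(_ _ h2) <- := mfr_aug_homog a.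
Qed.

End RegularityBound.

(** * Minimal generators of graded submodules *)

Section Generators.
Variables (K : fieldType) (n : nat).
Local Notation S := {mpoly K[n]}.
Implicit Types (m : 'X_{1..n}) (p f : S).

Definition is_submod q (N : set 'rV[S]_q) :=
  [/\ N 0, forall v w, N v -> N w -> N (v + w) & forall c v, N v -> N (c *: v)].

Definition row_comp q (deg : 'I_q -> nat) d (v : 'rV[S]_q) : 'rV[S]_q :=
  \row_b mfilter (fun m => (mdeg m + deg b == d)%N) (v 0 b).

Definition is_graded q (deg : 'I_q -> nat) (N : set 'rV[S]_q) :=
  forall d v, N v -> N (row_comp deg d v).

(** The generated submodule, as an intersection to avoid coefficients. *)
Definition span q (s : seq 'rV[S]_q) : set 'rV[S]_q :=
  [set v | forall L, is_submod L -> (forall g, g \in s -> L g) -> L v].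

Lemma submod_sum q (N : set 'rV[S]_q) (T : Type) (r : seq T) (F : T -> 'rV[S]_q) :
  is_submod N -> (forall i, N (F i)) -> N (\sum_(i <- r) F i).
Proof. by move=> [N0 ND NZ] h; elim/big_rec: _ => [//|i x _]; apply: ND. Qed.

Lemma span_submod q (s : seq 'rV[S]_q) : is_submod (span s).
Proof.
split=> [L [] //|v w hv hw L hL Ls|c v hv L hL Ls].
  by case: (hL) => _ D _; apply: D; [exact: hv|exact: hw].
by case: (hL) => _ _ D; apply: D; exact: hv.
Qed.

Lemma row_compE q deg d (v : 'rV[S]_q) b m :
  (row_comp deg d v 0 b)@_m = if (mdeg m + deg b == d)%N then (v 0 b)@_m else 0.
Proof. by rewrite mxE mcoeff_mfilter. Qed.

Lemma row_comp_homog q deg d (v : 'rV[S]_q) : homog_row deg d (row_comp deg d v).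
Proof.
by move=> b m; rewrite mcoeff_msupp row_compE; case: ifP => [/eqP//|_]; rewrite eqxx.
Qed.

Lemma row_comp_id q deg d (v : 'rV[S]_q) : homog_row deg d v -> row_comp deg d v = v.
Proof.
move=> h; apply/rowP=> b; apply/mpolyP=> m; rewrite row_compE; case: eqP => // ne.
apply/esym/memN_msupp_eq0/negP=> /h; exact: ne.
Qed.

Lemma row_comp_sum q deg (v : 'rV[S]_q) :
  exists D, v = \sum_(d < D) row_comp deg d v.
Proof.
exists (\sum_b (msize (v 0%R b) + deg b))%N.
apply/rowP=> b; apply/mpolyP=> m; rewrite summxE raddf_sum /=.
under eq_bigr do rewrite row_compE.
have [ms|ms] := boolP (m \in msupp (v 0%R b)); last first.
  by rewrite big1 (memN_msupp_eq0 ms) // => d _; rewrite if_same.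
have lt : (mdeg m + deg b < \sum_b (msize (v 0%R b) + deg b))%N.
  apply: (@leq_trans (msize (v 0%R b) + deg b)%N).
    by rewrite ltn_add2r msize_mdeg_lt.
  by rewrite (bigD1 b) //= leq_addr.
rewrite (bigD1 (Ordinal lt)) //= eqxx big1 ?addr0 // => d ne.
case: eqP => // E; move: ne; rewrite -val_eqE /= E eqxx //.
Qed.

Lemma row_comp_lin q deg d (c : K) (v w : 'rV[S]_q) :
  row_comp deg d (c%:MP *: v + w) = c%:MP *: row_comp deg d v + row_comp deg d w.
Proof.
apply/rowP=> b; apply/mpolyP=> m; rewrite row_compE 4!mxE !mcoeffD !mcoeffCM !row_compE.
by case: ifP => //; rewrite mulr0 addr0.
Qed.

Lemma row_comp_mulmx r q degr degq (A : 'M[S]_(r, q)) d v :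
  homog_mx degr degq A -> row_comp degq d (v *m A) = row_comp degr d v *m A.
Proof.
move=> hA; apply/rowP=> b; apply/mpolyP=> m; rewrite row_compE !mxE !raddf_sum /=.
rewrite [LHS](_ : _ = \sum_a if (mdeg m + degq b == d)%N then (v 0%R a * A a b)@_m else 0);
  last by case: ifP => // _; rewrite big1.
apply: eq_bigr => a _; rewrite [RHS]mcoeffM.
have key k1 k2 : m = (k1 + k2)%MM -> (row_comp degr d v 0 a)@_k1 * (A a b)@_k2 =
    if (mdeg m + degq b == d)%N then (v 0%R a)@_k1 * (A a b)@_k2 else 0.
  move=> E; rewrite row_compE.
  have [ms|ms] := boolP (k2 \in msupp (A a b)); last first.
    by rewrite (memN_msupp_eq0 ms) !mulr0 if_same.
  have /homog_diffP/(_ _ ms) Ed := hA a b.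
  by rewrite E mdegD -addnA Ed; case: ifP => _ //; rewrite mul0r.
rewrite (eq_bigr _ (fun k hk => key _ _ (eqP hk))).
by case: ifP => _; [rewrite mcoeffM|rewrite big1].
Qed.

Lemma row_comp_mulX q deg d i (v : 'rV[S]_q) :
  row_comp deg d.+1 ('X_i *: v) = 'X_i *: row_comp deg d v.
Proof.
apply/rowP=> b; apply/mpolyP=> m; rewrite row_compE !mxE !(mulrC 'X_i) !mcoeffMXi.
case: (ltnP 0 (m i)) => mi; last by rewrite if_same.
by rewrite mcoeff_mfilter -(mdegBU mi) addSn eqSS.
Qed.

Lemma row_comp_sumE q deg d (T : finType) (F : T -> 'rV[S]_q) :
  row_comp deg d (\sum_i F i) = \sum_i row_comp deg d (F i).
Proof.
apply/rowP=> b; apply/mpolyP=> m; rewrite row_compE !summxE !raddf_sum /=.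
under [RHS]eq_bigr do rewrite row_compE.
by case: ifP => // _; rewrite big1.
Qed.

(** A subspace of largest dimension among those inside [W] is all of [W]. *)
Lemma fin_subspace (V : vectType K) (W : set V) : W 0 ->
  (forall c x y, W x -> W y -> W (c *: x + y)) ->
  exists U : {vspace V}, forall x, x \in U <-> W x.
Proof.
move=> W0 WL.
have [e [[U [UW EU]] emax]] :
    exists e, (exists U : {vspace V}, (forall x, x \in U -> W x) /\ \dim U = e) /\
     forall j, (exists U : {vspace V}, (forall x, x \in U -> W x) /\ \dim U = j) ->
       (j <= e)%N.
  apply: (@ex_max_nat _ (dim V)); last first.
    by move=> _ [U [_ <-]]; rewrite -dimvf dimvS ?subvf.
  by exists (\dim (0%VS : {vspace V})), 0%VS; split=> // x; rewrite memv0 => /eqP ->.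
exists U => x; split; first exact: UW.
move=> Wx; have sub : (U <= U + <[x]>)%VS by exact: addvSl.
have le : (\dim (U + <[x]>)%VS <= \dim U)%N.
  rewrite EU; apply: emax; exists (U + <[x]>)%VS; split=> // _ /memv_addP[u uU [_ /vlineP[c ->] ->]].
  by rewrite addrC; apply: WL => //; exact: UW.
have /eqP -> : U == (U + <[x]>)%VS by rewrite eqEdim sub le.
exact: (subvP (addvSr _ _)) (memv_line x).
Qed.

(** The elements of degree [d] form a finite-dimensional vector space over [K]:
    they are encoded by their coefficients at monomials of degree at most [d]. *)
Lemma homog_piece_generators q deg (N : set 'rV[S]_q) d : is_submod N ->
  exists s : seq 'rV[S]_q, (forall g, g \in s -> N g /\ homog_row deg d g) /\
    forall v, N v -> homog_row deg d v -> span s v.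
Proof.
move=> [N0 ND NZ].
pose B := ('I_q * 'X_{1..n < d.+1})%type.
pose V := {ffun B -> K^o}.
pose phi (c : V) : 'rV[S]_q :=
  \row_b \sum_(m : 'X_{1..n < d.+1}) (c (b, m) : K) *: ('X_[m] : S).
have phiL a x y : phi (a *: x + y) = a%:MP *: phi x + phi y.
  apply/rowP=> b; rewrite !mxE mulr_sumr -big_split; apply: eq_bigr => m _.
  by rewrite !ffunE mul_mpolyC scalerDl scalerA.
have phi0 : phi 0 = 0.
  by apply/rowP=> b; rewrite !mxE big1 // => m _; rewrite ffunE scale0r.
have homogL (a : K) (x y : 'rV[S]_q) : homog_row deg d x -> homog_row deg d y ->
    homog_row deg d (a%:MP *: x + y).
  move=> hx hy; rewrite -(row_comp_id hx) -(row_comp_id hy) -row_comp_lin.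
  exact: row_comp_homog.
have homog0 : homog_row deg d (0 : 'rV[S]_q).
  by move=> b m; rewrite mxE -[0]/(0%:MP) msupp0.
pose W : set V := [set c | N (phi c) /\ homog_row deg d (phi c)].
have [||U UW] := @fin_subspace V W.
- by rewrite /W /= phi0.
- move=> a x y [Nx hx] [Ny hy]; rewrite /W /= phiL; split; last exact: homogL.
  by apply: ND => //; exact: NZ.
exists [seq phi c | c <- vbasis U]; split.
  by move=> _ /mapP[c /vbasis_mem/UW[Nc hc] ->].
move=> v Nv hv L [L0 LD LZ] Ls.
pose c : V := [ffun x => (v 0 x.1)@_(bmnm x.2)].
have Ec : phi c = v.
  apply/rowP=> b; rewrite mxE; apply/mpolyP=> m.
  rewrite (eq_bigr (fun m : 'X_{1..n < d.+1} => (v 0 b)@_m *: ('X_[m] : S))) => [|m' _];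
    last by rewrite ffunE.
  apply: (@mcoeff_bounded_sum _ _ (fun m => (v 0 b)@_m)) => m' le.
  by apply: memN_msupp_eq0; apply/negP=> /hv; lia.
have cU : c \in U by apply/UW; rewrite /W /= Ec.
rewrite -Ec (coord_vbasis cU).
elim/big_ind: _ => [|x y Lx Ly|i _].
- by rewrite phi0.
- by rewrite -[x]scale1r phiL mpolyC1 scale1r; apply: LD.
rewrite -[_ *: _]addr0 phiL phi0 addr0; apply: LZ; apply: Ls.
by apply: map_f; apply: mem_nth; rewrite size_tuple.
Qed.

(** By [nakayama_kos], an element of degree greater than [e] is a combination of
    elements of [N] of smaller degree, so the pieces of degree at most [e]
    generate. *)
Lemma homog_generators q deg (N : set 'rV[S]_q) e : is_submod N ->
  is_graded deg N -> row_vanishing deg N e ->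
  exists s : seq 'rV[S]_q, (forall g, g \in s -> N g /\ exists d, homog_row deg d g) /\
    forall v, N v -> span s v.
Proof.
move=> subN grN van.
have /choice[s sP] := fun d => homog_piece_generators deg d subN.
exists (flatten [seq s d | d <- iota 0 e.+1]); split.
  by move=> g /flatten_mapP[d _ /(proj1 (sP d))[Ng hg]]; split=> //; exists d.
set gens := flatten _.
suff hom d v : N v -> homog_row deg d v -> span gens v.
  move=> v Nv; have [D ->] := row_comp_sum deg v.
  apply: (submod_sum _ (span_submod gens)).
  by move=> d; apply: (hom d); [exact: grN|exact: row_comp_homog].
elim: d v => [|d IH] v Nv hv.
  move=> L hL Ls; apply: (proj2 (sP 0%N) v Nv hv L hL) => g gs; apply: Ls.
  by apply/flatten_mapP; exists 0%N.
have [le|lt] := leqP d.+1 e.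
  move=> L hL Ls; apply: (proj2 (sP d.+1) v Nv hv L hL) => g gs; apply: Ls.
  by apply/flatten_mapP; exists d.+1; rewrite // mem_iota.
have [|||y [yN vE]] := @nakayama_kos _ _ _ deg N e v _ van.
- by case: subN.
- by [].
- by move=> b m /hv ->.
have [_ _ spZ] := span_submod gens.
rewrite -(row_comp_id hv) vE row_comp_sumE; apply: (submod_sum _ (span_submod gens)) => i.
rewrite row_comp_mulX; apply: spZ; apply: IH; first exact: grN.
exact: row_comp_homog.
Qed.

(** Take the least possible number of homogeneous generators.  A relation with a
    nonzero constant coefficient has a homogeneous component in which that
    coefficient is a nonzero constant, so the corresponding generator could be
    removed. *)
Lemma minimal_generators q deg (N : set 'rV[S]_q) e : is_submod N ->
  is_graded deg N -> row_vanishing deg N e ->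
  exists r (degr : 'I_r -> nat) (A : 'M[S]_(r, q)),
    [/\ homog_mx degr deg A, row_image A = N & in_max_ideal (row_kernel A)].
Proof.
move=> subN grN van.
pose gen r := exists (degr : 'I_r -> nat) (A : 'M[S]_(r, q)),
  homog_mx degr deg A /\ row_image A = N.
have image_submod r (A : 'M[S]_(r, q)) : is_submod (row_image A).
  split; first by exists 0; rewrite mul0mx.
    by move=> _ _ [v ->] [w ->]; exists (v + w); rewrite mulmxDl.
  by move=> c _ [v ->]; exists (c *: v); rewrite scalemxAl.
have [r [[degr [A [hA imA]]] rmin]] : exists r, gen r /\ forall j, gen j -> (r <= j)%N.
  apply: ex_min_nat; have [s [sN sspan]] := homog_generators subN grN van.
  have sd (a : 'I_(size s)) : exists d, homog_row deg d (s`_a).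
    by have [_] := sN _ (mem_nth 0 (ltn_ord a)).
  have /choice[degr degrP] := sd.
  exists (size s), degr, (\matrix_(a < size s) s`_a); split.
    by move=> a b; apply/homog_diffP => m; rewrite mxE => /degrP.
  apply/seteqP; split=> w.
    move=> [v ->]; rewrite mulmx_sum_row; apply: (submod_sum _ subN) => a.
    rewrite rowK; have [_ _ NZ] := subN; apply: NZ.
    by have [] := sN _ (mem_nth 0 (ltn_ord a)).
  move=> /sspan; apply; first exact: image_submod.
  move=> g gs; have ig : (index g s < size s)%N by rewrite index_mem.
  exists (delta_mx 0 (Ordinal ig)); rewrite -rowE rowK /= nth_index //.
exists r, degr, A; split=> // v kv a; apply/eqP/negPn/negP=> c0.
have [r' Er] : exists r', r = r'.+1 by exists r.-1; rewrite prednK // (leq_ltn_trans _ (ltn_ord a)).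
subst r; suff /rmin : gen r' by rewrite ltnn.
pose v' := row_comp degr (degr a) v.
have kv' : v' *m A = 0.
  rewrite -(row_comp_mulmx _ _ hA) kv; apply/rowP=> b; apply/mpolyP=> m.
  by rewrite row_compE !mxE mcoeff0 if_same.
have va : v' 0 a = ((v 0 a)@_0%MM)%:MP.
  apply/mpolyP=> m; rewrite row_compE mcoeffC -[X in _ == X]add0n eqn_add2r mdeg_eq0.
  by case: eqP => [->|_]; rewrite ?mulr1 ?mulr0.
exists (degr \o lift a), (row' a A); split.
  by move=> b b'; rewrite mxE; exact: hA.
apply/seteqP; split=> w.
  move=> [u ->]; rewrite -imA.
  exists (\row_b if unlift a b is Some j then u 0 j else 0).
  apply/rowP=> b; rewrite !mxE (bigD1_ord a) //= mxE unlift_none mul0r add0r.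
  by apply: eq_bigr => j _; rewrite !mxE liftK.
rewrite -imA => -[u ->].
pose u' := u - (u 0 a * ((v 0 a)@_0%MM)^-1%:MP) *: v'.
have u'a : u' 0 a = 0.
  rewrite (_ : u' 0 a = u 0 a - u 0 a * ((v 0 a)@_0%MM)^-1%:MP * v' 0 a).
    by rewrite va -mulrA -mpolyCM mulVf // mulr1 subrr.
  by rewrite !mxE.
have -> : u *m A = u' *m A by rewrite mulmxBl -scalemxAl kv' scaler0 subr0.
exists (col' a u'); apply/rowP=> b.
rewrite mxE (bigD1_ord a) //= u'a mul0r add0r mxE.
by apply: eq_bigr => j _; congr (_ * _); rewrite [RHS]mxE.
Qed.

End Generators.

(** * Existence of minimal free resolutions *)

Section Resolutions.
Variables (K : fieldType) (n : nat).
Local Notation S := {mpoly K[n]}.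

(** What is needed of a submodule in order to cover it minimally; the kernel of
    the cover is again of this kind, which makes the construction iterate. *)
Record good_module := GoodModule {
  gm_rk : nat;
  gm_deg : 'I_gm_rk -> nat;
  gm_set : set 'rV[S]_gm_rk;
  gm_bound : nat;
  gm_submod : is_submod gm_set;
  gm_graded : is_graded gm_deg gm_set;
  gm_van : row_vanishing gm_deg gm_set gm_bound
}.

Definition cover_of (M : good_module)
    (X : {r : nat & (('I_r -> nat) * 'M[S]_(r, gm_rk M))%type}) :=
  let: existT r (degr, A) := X in
  [/\ homog_mx degr (@gm_deg M) A, row_image A = @gm_set M &
      in_max_ideal (row_kernel A)].

Lemma cover_exists M : exists X, @cover_of M X.
Proof.
have [r [degr [A h]]] := minimal_generators (gm_submod M) (@gm_graded M) (@gm_van M).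
by exists (existT _ r (degr, A)).
Qed.

Definition cover M := projT1 (cid (cover_exists M)).
Definition cover_rk M := projT1 (cover M).
Definition cover_deg M := (projT2 (cover M)).1.
Definition cover_mx M : 'M[S]_(cover_rk M, gm_rk M) := (projT2 (cover M)).2.

Lemma coverP M : [/\ homog_mx (@cover_deg M) (@gm_deg M) (cover_mx M),
  row_image (cover_mx M) = @gm_set M & in_max_ideal (row_kernel (cover_mx M))].
Proof.
rewrite /cover_mx /cover_deg /cover_rk /cover; case: (cid _) => -[r [degr A]] /= h.
exact: h.
Qed.

Lemma kernel_submod r q (A : 'M[S]_(r, q)) : is_submod (row_kernel A).
Proof.
split; rewrite /row_kernel /=; first by rewrite mul0mx.
  by move=> v w hv hw; rewrite mulmxDl hv hw addr0.
by move=> c v hv; rewrite -scalemxAl hv scaler0.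
Qed.

Lemma kernel_graded r q degr degq (A : 'M[S]_(r, q)) :
  homog_mx degr degq A -> is_graded degr (row_kernel A).
Proof.
move=> hA d v kv; rewrite /row_kernel /= -(row_comp_mulmx _ _ hA) kv.
by apply/rowP=> b; apply/mpolyP=> m; rewrite row_compE !mxE mcoeff0 if_same.
Qed.

Lemma cover_graded M : is_graded (@cover_deg M) (row_kernel (cover_mx M)).
Proof. by have [hA _ _] := coverP M; exact: kernel_graded hA. Qed.

Lemma cover_van M :
  row_vanishing (@cover_deg M) (row_kernel (cover_mx M)) (gm_bound M).+1.
Proof.
have [hA im ker] := coverP M; apply: (vanishing_shift hA ker).
by rewrite im; exact: gm_van.
Qed.

Definition syzygies M : good_module :=
  GoodModule (kernel_submod (cover_mx M)) (@cover_graded M) (@cover_van M).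

(** Iterate [syzygies] from the ideal, seen as a submodule of the free module of
    rank one; the differentials are the successive minimal covers. *)
Lemma resolution_exists (M : set 'X_{1..n}) e :
  upset M -> koszul_vanishing K M e -> inhabited (min_free_res (monid M : set S)).
Proof.
move=> uM van.
have sub : is_submod (ideal_rows (monid M : set S)).
  split; rewrite /ideal_rows /=; first by rewrite mxE; exact: monid0.
    by move=> v w hv hw; rewrite mxE; exact: monidD.
  by move=> c v hv; rewrite mxE; exact: monidM.
have gr : is_graded (fun=> 0%N) (ideal_rows (monid M : set S)).
  move=> d v hv m; rewrite mcoeff_msupp row_compE; case: ifP => _; last by rewrite eqxx.
  by rewrite -mcoeff_msupp; exact: hv.
pose M0 := GoodModule sub gr (ideal_rows_vanishing van).
pose Z k := iter k syzygies M0.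
have [hom0 im0 _] := coverP M0.
constructor; unshelve refine (@MinFreeRes K n (monid M) (fun k => gm_rk (Z k.+1))
  (fun k => @gm_deg (Z k.+1)) (cover_mx M0) (fun k => cover_mx (Z k.+1)) _ _ _ _ _ _).
- by move=> a; have := hom0 a 0; rewrite /homog_diff /= subn0.
- by move=> i a b; have [h _ _] := coverP (Z i.+1); exact: h.
- move=> f; split.
    move=> hf; have : @gm_set M0 (const_mx f) by rewrite /= /ideal_rows /= mxE.
    by rewrite -im0 => -[v vE]; exists v; rewrite -vE mxE.
  move=> [v <-]; have : row_image (cover_mx M0) (v *m cover_mx M0) by exists v.
  by rewrite im0.
- move=> v; have [_ im _] := coverP (Z 1%N); split.
    by move=> kv; have : @gm_set (Z 1%N) v by []; rewrite -im.
  by move=> [w ->]; have : @gm_set (Z 1%N) (w *m cover_mx (Z 1%N)) by rewrite -im; exists w.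
- move=> i v; have [_ im _] := coverP (Z i.+2); split.
    by move=> kv; have : @gm_set (Z i.+2) v by []; rewrite -im.
  by move=> [w ->]; have : @gm_set (Z i.+2) (w *m cover_mx (Z i.+2)) by rewrite -im; exists w.
move=> i a b; have [_ _ ker] := coverP (Z i).
have [_ im _] := coverP (Z i.+1).
have : @gm_set (Z i.+1) (row a (cover_mx (Z i.+1))).
  by rewrite -im; exists (delta_mx 0 a); rewrite rowE.
by move=> /ker/(_ b); rewrite mxE.
Qed.

End Resolutions.

(** * Comparison of regularities *)

Section Regularity.
Variables (K : fieldType) (n : nat).
Local Notation S := {mpoly K[n]}.

Lemma reg_le (M : set 'X_{1..n}) e : koszul_vanishing K M e ->
  (reg (monid M : set S) <= (e%:Z)%:E)%E.
Proof.
move=> van; rewrite /reg /supremum; case: ifP => _; first exact: leNye.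
case: xgetP => [x _ [_ lub]|_]; last exact: leNye.
apply: lub => _ [F [i [a ->]]]; rewrite lee_fin.
by have := resolution_degree_bound van a; lia.
Qed.

(** The degrees in question are bounded by [e], so their supremum exists; it is
    reached at the least possible distance [k] below [e]. *)
Lemma generator_degree_le_reg (M : set 'X_{1..n}) e m :
  upset M -> koszul_vanishing K M e -> M m ->
  (forall i : 'I_n, (0 < m i)%N -> ~ M (m - U_(i))%MM) ->
  (((mdeg m)%:Z)%:E <= reg (monid M : set S))%E.
Proof.
move=> uM van Mm mmin; have [F] := resolution_exists uM van.
have [a Ea] := minimal_monomial_degree F Mm mmin uM.
rewrite /reg; set E := [set x | _].
have Em : E ((mdeg m)%:Z)%:E by exists F, 0%N, a; rewrite Ea subr0.
have [k [Ek kmin]] : exists k, E ((e%:Z - k%:Z)%:E)%E /\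
    forall j, E ((e%:Z - j%:Z)%:E)%E -> (k <= j)%N.
  apply: ex_min_nat; exists (e - mdeg m)%N.
  rewrite (_ : e%:Z - (e - mdeg m)%N%:Z = (mdeg m)%:Z) //.
  by have := resolution_degree_bound van a; rewrite Ea; lia.
rewrite /supremum; case: eqP => [E0|_]; first by rewrite E0 in Em.
case: xgetP => [x _ [ub _]|no]; first exact: ub.
case: (no ((e%:Z - k%:Z)%:E)%E); split; last by move=> y; apply.
move=> x Ex; have [G [i [b xE]]] := Ex; rewrite xE lee_fin.
have := resolution_degree_bound van b.
have := kmin (e + i - mfr_deg b)%N.
rewrite (_ : e%:Z - (e + i - mfr_deg b)%N%:Z = (mfr_deg b)%:Z - i%:Z) => [|]; last first.
  by have := resolution_degree_bound van b; lia.
rewrite -xE => /(_ Ex); lia.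
Qed.

End Regularity.

Theorem corollary1p3 (K : fieldType) (n : nat) (I : set {mpoly K[n]})
    (hI : polymatroidal I) (hemb : no_embedded_primes I) (k : nat)
    (hk : (1 <= k)%N) :
  (reg (ideal_exp I k) <= reg (symbolic_power I k))%E.
Proof.
have [I0 [A [[IE _] [d Adeg] Aex]]] := hI.
rewrite monomial_idealE in IE.
have [u Au] : exists u, A u.
  apply: contrapT => no; apply: I0; rewrite IE; apply/seteqP; split=> f.
    by move=> hf; apply: monid_set0 => m /hf[u Au]; case: no; exists u.
  by move=> ->; exact: monid0.
rewrite {}IE in hemb *.
have uS := @symbolic_monomials_upset K n A k.
rewrite ideal_expE (symbolic_powerE K Adeg).
apply: (@le_trans _ _ ((k * d)%:Z)%:E).
  apply: reg_le; apply: exchange_vanishing; first exact: ksum_mdeg.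
  exact: ksum_exchange.
have -> : (k * d = mdeg (u *+ k)%MM)%N by rewrite mdegMn (Adeg _ Au) mulnC.
apply: (@generator_degree_le_reg _ _ _ (n * (k * d))) => //.
- apply: capped_vanishing => // m l; exact: symbolic_monomials_capped.
- exact: symbolic_monomials_power.
move=> i; rewrite mulmnE muln_gt0 => /andP[ui _].
exact: (power_not_divisible Adeg Aex hemb Au ui hk).
Qed.
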